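(* Let $\lambda$ be a frequency. For $1\le p<\infty$, the sequence $\{e^{-\lambda_n s}\}$ is an unconditional Schauder basis of $\mathcal H_p^\lambda$ if and only if $\mathcal H_p^\lambda=\mathcal H_2^\lambda$ with equivalent norms. Respectively, $\{e^{-\lambda_n s}\}$ is an unconditional Schauder basis of $\mathcal A_\infty^\lambda$ if and only if $\mathcal A_\infty^\lambda=\ell_1$ with equivalent norms.
   Context: A frequency is a strictly increasing unbounded sequence $\lambda=(\lambda_n)_{n\ge1}$ of non-negative real numbers. A $\lambda$-Dirichlet polynomial is a finite sum $D=\sum_{n\in A}a_n e^{-\lambda_n s}$, with $A\subset\mathbb N$ finite and $a_n\in\mathbb C$. Its norms are $\|D\|_{\mathcal H_p^\lambda}=\lim_{R\to\infty}\big(\frac1{2R}\int_{-R}^R|\sum_{n\in A}a_n e^{-\lambda_n it}|^p\,dt\big)^{1/p}$ for $1\le p<\infty$ and $\|D\|_{\mathcal H_\infty^\lambda}=\sup_{t\in\mathbb R}|\sum_{n\in A}a_n e^{-i\lambda_n t}|$. The spaces $\mathcal H_p^\lambda$ ($1\le p<\infty$) and $\mathcal A_\infty^\lambda$ are the completions of the space of $\lambda$-Dirichlet polynomials under $\|\cdot\|_{\mathcal H_p^\lambda}$ and $\|\cdot\|_{\mathcal H_\infty^\lambda}$, respectively. ''$\mathcal H_p^\lambda=\mathcal H_2^\lambda$ with equivalent norms'' means that the norms $\|\cdot\|_{\mathcal H_p^\lambda}$ and $\|\cdot\|_{\mathcal H_2^\lambda}$ are equivalent on $\lambda$-Dirichlet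 polynomials (so the completions coincide). ''$\mathcal A_\infty^\lambda=\ell_1$ with equivalent norms'' is understood by identifying each Dirichlet series with its sequence of coefficients, i.e. $\|\sum_{n\in A}a_n e^{-\lambda_n s}\|_{\mathcal H_\infty^\lambda}$ and $\sum_{n\in A}|a_n|$ are equivalent norms on $\lambda$-Dirichlet polynomials. A Schauder basis $(\mathbf x_n)$ of a Banach space $\mathbb X$, with biorthogonal functionals $(\mathbf x_n^* )$, is unconditional if there is $C>0$ such that $\|\sum_{j}a_j\mathbf x_j^*(x)\mathbf x_j\|\le C\|x\|$ for all $x\in\mathbb X$ and all scalars $(a_j)$ with $|a_j|\le1$ for all $j$. *)

(* Defs.v *)
From HB Require Import structures.
From mathcomp Require Import all_boot all_order all_algebra.
From mathcomp Require Import all_classical all_reals all_analysis.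
From mathcomp Require Export complex.

Set Implicit Arguments.
Unset Strict Implicit.
Unset Printing Implicit Defensive.

Import Order.TTheory GRing.Theory Num.Theory.
Import numFieldNormedType.Exports.
Local Open Scope classical_set_scope.
Local Open Scope ring_scope.
Local Open Scope complex_scope.

Definition schauder_basis (K : numFieldType) (X : normedModType K)
    (x : nat -> X) : Prop :=
  forall v : X, exists! c : nat -> K,
    series (fun n => c n *: x n) @ \oo --> v.

(* For a Schauder basis of a Banach space these functionals exist and are
   unique: they are the coordinate functionals. *)
Definition biorthogonal_functionals (K : numFieldType) (X : normedModType K)
    (x : nat -> X) (xs : nat -> {linear X -> K^o}) : Prop :=
  (forall n, continuous (xs n)) /\
  (forall m n, xs m (x n) = (m == n)%:R).

Definition unconditional_basis (K : numFieldType) (X : normedModType K)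
    (x : nat -> X) : Prop :=
  schauder_basis x /\
  exists2 xs : nat -> {linear X -> K^o}, biorthogonal_functionals x xs &
  exists2 C : K, 0 < C &
  forall (v : X) (a : nat -> K), (forall j, `|a j| <= 1) ->
    let u := series (fun j => (a j * xs j v) *: x j) in
    cvgn u /\ `|limn u| <= C * `|v|.

(* (X, iota) is a completion of the complex vector space V for the real-valued
   norm N; the norm of X takes its values in the nonnegative reals of R[i]. *)
Definition is_completion (R : realType) (V : lmodType R[i]) (N : V -> R)
    (X : completeNormedModType R[i]) (iota : {linear V -> X}) : Prop :=
  (forall v : V, `|iota v| = (N v)%:C) /\ dense (range iota).

Definition equivalent_norms (R : realType) (V : Type) (N1 N2 : V -> R) : Prop :=
  exists c C : R, [/\ 0 < c, 0 < C &
    forall v : V, c * N1 v <= N2 v /\ N2 v <= C * N1 v].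

Definition frequency (R : realType) (lam : nat -> R) : Prop :=
  [/\ forall n, 0 <= lam n,
      forall m n, (m < n)%N -> lam m < lam n &
      forall M, exists n, M < lam n].

Definition cexp (R : realType) (z : R[i]) : R[i] :=
  (expR (complex.Re z))%:C * (cos (complex.Im z) +i* sin (complex.Im z)).

(* A lambda-Dirichlet polynomial \sum_n a_n e^{- lambda_n s} is given by its
   finitely supported coefficient sequence (a_n), indexed from 0 and stored as
   an element of {poly R[i]}.  Only the vector space structure of {poly R[i]}
   is meaningful; 'X^n stands for e^{- lambda_n s}, not for a power. *)
Notation dirichlet_poly R := {poly R[i]}.

Definition dirichlet_monomial (R : realType) (n : nat) : dirichlet_poly R :=
  'X^n.

Definition dirichlet_eval (R : realType) (lam : nat -> R)
    (D : dirichlet_poly R) (s : R[i]) : R[i] :=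
  \sum_(n < size D) D`_n * cexp (- (lam n)%:C * s).

Definition dirichlet_abs (R : realType) (lam : nat -> R)
    (D : dirichlet_poly R) (t : R) : R :=
  Normc.normc (dirichlet_eval lam D (0 +i* t)).

Definition norm_Hp (R : realType) (lam : nat -> R) (p : R)
    (D : dirichlet_poly R) : R :=
  lim ((((2 * T)^-1 * \int[lebesgue_measure]_(t in `[- T, T])
          (dirichlet_abs lam D t `^ p)) `^ p^-1) @[T --> +oo]).

Definition norm_Hoo (R : realType) (lam : nat -> R) (D : dirichlet_poly R) : R :=
  sup (range (dirichlet_abs lam D)).

Definition norm_ell1 (R : realType) (D : dirichlet_poly R) : R :=
  \sum_(n < size D) Normc.normc D`_n.

(* Main.v *)
Require Import Defs.
From HB Require Import structures.
From mathcomp Require Import all_boot all_order all_algebra.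
From mathcomp Require Import all_classical all_reals all_analysis.
From mathcomp Require Import ring lra.

Set Implicit Arguments.
Unset Strict Implicit.
Unset Printing Implicit Defensive.

Import Order.TTheory GRing.Theory Num.Theory.
Import numFieldNormedType.Exports.
Local Open Scope classical_set_scope.
Local Open Scope ring_scope.
Local Open Scope complex_scope.

(** Both equivalences pass through one property of the norm [N]: for some [C],
    multiplying the coefficients of a Dirichlet polynomial by numbers of modulus
    at most 1 increases [N] at most by the factor [C] ([multiplier_bound]).

    In any completion of the Dirichlet polynomials in which the monomials have
    norm 1, this property says that the monomials form an unconditional basis.
    An unconditional basis gives it by restriction
    ([unconditional_multiplier_bound]).  Conversely
    ([multiplier_bound_unconditional]), the indicator of an index is a
    multiplier, hence coefficients are bounded functionals and extend to the
    completion; the truncated multipliers bound the partial sums uniformly, and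
    on the dense subspace these sums are eventually constant.

    The Hilbert norm, by orthogonality the l2 norm of the coefficients, and the
    l1 norm have the property with [C = 1].  It passes to equivalent norms, with
    another constant ([equivalent_norms_multiplier_bound]).

    Suppose that the norm of [H_p] has the property.  Changing the signs of the
    coefficients then alters the norm by a factor of at most [C] either way, so
    its [p]-th power is comparable with the average of [p]-th powers over all
    signs, and that average may be taken before the mean over [t].  What remains
    is Khinchine's argument ([norm_Hp_bounds_on_l2_sphere]).  At each [t] the
    exponential moments of a Rademacher sum bound all its power moments in terms
    of the l2 norm ([rademacher_moment]), which settles the upper estimate.  For
    the lower one the second moment, whose mean over [t] is exactly the squared
    l2 norm, is interpolated between the [p]-th and the fourth
    ([sqr_le_powR_quartic]).

    Suppose that the supremum norm has the property.  Multipliers turn the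
    coefficients into their moduli, and the value at [t = 0] becomes the l1
    norm ([multiplier_bound_ell1_le]); the reverse estimate is the triangle
    inequality.

    Integrating such inequalities over [t] requires that the limit defining the
    [H_p] norm exists.  The square of the modulus of a Dirichlet polynomial is a
    trigonometric polynomial, which has a mean value; a continuous function of
    it is a uniform limit of trigonometric polynomials by Bernstein's form of
    Weierstrass' theorem, and mean values survive uniform limits
    ([has_mean_comp_trigpoly], [has_mean_norm_Hp]). *)

(** * The modulus of a complex number *)

Section ComplexModulus.
Context {R : realType}.
Implicit Types (z u v : R[i]).

Lemma normc_ge0 z : 0 <= Normc.normc z.
Proof. by case: z => x y; exact: sqrtr_ge0. Qed.

Lemma normc_sqr z :
  Normc.normc z ^+ 2 = complex.Re z ^+ 2 + complex.Im z ^+ 2.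
Proof. by case: z => a b /=; rewrite sqr_sqrtr// addr_ge0 ?sqr_ge0. Qed.

Lemma Re_le_normc z : complex.Re z <= Normc.normc z.
Proof.
case: z => x y /=; apply: le_trans (ler_norm x) _.
by rewrite -sqrtr_sqr ler_wsqrtr// lerDl sqr_ge0.
Qed.

Lemma Im_le_normc z : complex.Im z <= Normc.normc z.
Proof.
case: z => x y /=; apply: le_trans (ler_norm y) _.
by rewrite -sqrtr_sqr ler_wsqrtr// lerDr sqr_ge0.
Qed.

(** Stated for any square root [r] of [x ^+ 2 + y ^+ 2], so that it also serves
    when the modulus is not given by a complex number. *)
Lemma le_add_norm_of_sqr (r x y : R) : 0 <= r -> r ^+ 2 = x ^+ 2 + y ^+ 2 ->
  r <= `|x| + `|y|.
Proof.
move=> r0 rE; rewrite -(@ler_pXn2r _ 2)// ?nnegrE ?addr_ge0// rE.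
rewrite -(real_normK (num_real x)) -(real_normK (num_real y)) sqrrD.
have : 0 <= `|x| * `|y| by rewrite mulr_ge0.
lra.
Qed.

Lemma normc_mult_le u v : Normc.normc u <= 1 ->
  Normc.normc (u * v) <= Normc.normc v.
Proof. by move=> u1; rewrite Normc.normcM ler_piMl// normc_ge0. Qed.

Lemma normc_nonneg (x : R) : 0 <= x -> Normc.normc x%:C = x.
Proof. by move=> x0; rewrite /= expr0n/= addr0 sqrtr_sqr ger0_norm. Qed.

Lemma normc_cis (x : R) : Normc.normc (cos x +i* - sin x) = 1.
Proof. by rewrite /= sqrrN cos2Dsin2 sqrtr1. Qed.

Lemma complex_norm_le1 z : (`|z| <= 1) = (Normc.normc z <= 1).
Proof. exact: (lecR (Normc.normc z) 1). Qed.

Lemma gt0_complexE z : 0 < z -> z = (complex.Re z)%:C /\ 0 < complex.Re z.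
Proof. by case: z => x y; rewrite ltcE/= => /andP[/eqP -> ?]. Qed.

Lemma Re_sum (I : Type) (r : seq I) (F : I -> R[i]) :
  complex.Re (\sum_(i <- r) F i) = \sum_(i <- r) complex.Re (F i).
Proof. by apply: (big_morph _ _ erefl) => -[a b] [c d]. Qed.

Lemma Im_sum (I : Type) (r : seq I) (F : I -> R[i]) :
  complex.Im (\sum_(i <- r) F i) = \sum_(i <- r) complex.Im (F i).
Proof. by apply: (big_morph _ _ erefl) => -[a b] [c d]. Qed.

End ComplexModulus.

(** * Mean values on the real line *)

Section MeanValues.
Context {R : realType}.
Implicit Types (f g : R -> R) (m T : R).

Definition avg f T : R :=
  (2 * T)^-1 * \int[lebesgue_measure]_(t in `[- T, T]) f t.

Definition has_mean f m := avg f T @[T --> +oo] --> m.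

Let integrable_sym f T : continuous f ->
  lebesgue_measure.-integrable (`[- T, T] : set R) (EFin \o f).
Proof.
move=> cf; apply: continuous_compact_integrable; first exact: segment_compact.
exact: continuous_subspaceT.
Qed.

Lemma avgD f g T : continuous f -> continuous g ->
  avg (fun t => f t + g t) T = avg f T + avg g T.
Proof.
by move=> cf cg; rewrite /avg RintegralD ?mulrDr//; exact: integrable_sym.
Qed.

Lemma avgZ k f T : continuous f -> avg (fun t => k * f t) T = k * avg f T.
Proof.
by move=> cf; rewrite /avg RintegralZl 1?mulrCA//; exact: integrable_sym.
Qed.

Lemma avg_cst k T : 0 < T -> avg (fun=> k) T = k.
Proof.
move=> T0; rewrite /avg Rintegral_cst//= lebesgue_measure_itv/= lte_fin.
by rewrite gtrN// -EFinD/=; field; lra.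
Qed.

Lemma le_avg f g T : continuous f -> continuous g -> 0 < T ->
  (forall t, f t <= g t) -> avg f T <= avg g T.
Proof.
move=> cf cg T0 fg; rewrite /avg; apply: ler_wpM2l.
  by rewrite invr_ge0 mulr_ge0// ltW.
by apply: le_Rintegral => //; exact: integrable_sym.
Qed.

Lemma has_mean_unique f m1 m2 : has_mean f m1 -> has_mean f m2 -> m1 = m2.
Proof. by apply: cvg_unique. Qed.

Lemma has_mean_cst k : has_mean (fun=> k) k.
Proof.
apply: cvg_near_cst; near=> T; apply: avg_cst; near: T; exact: nbhs_pinfty_gt.
Unshelve. all: by end_near. Qed.

Lemma has_meanD f g m1 m2 : continuous f -> continuous g ->
  has_mean f m1 -> has_mean g m2 -> has_mean (fun t => f t + g t) (m1 + m2).
Proof.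
move=> cf cg fm gm; rewrite /has_mean; under eq_fun do rewrite avgD//.
exact: cvgD.
Qed.

Lemma has_meanZ k f m : continuous f -> has_mean f m ->
  has_mean (fun t => k * f t) (k * m).
Proof.
move=> cf fm; rewrite /has_mean; under eq_fun do rewrite avgZ//.
exact: cvgMr.
Qed.

Lemma continuous_sum (I : Type) (r : seq I) (P : pred I) (F : I -> R -> R) :
  (forall i, continuous (F i)) ->
  continuous (fun t => \sum_(i <- r | P i) F i t).
Proof.
move=> cF; elim: r => [|i r IH].
  by under eq_fun do rewrite big_nil; exact: cst_continuous.
under eq_fun do rewrite big_cons; case: (P i) => // t.
by apply: cvgD; [exact: cF|exact: IH].
Qed.

Lemma has_mean_sum (I : Type) (r : seq I) (P : pred I) (F : I -> R -> R)
    (m : I -> R) :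
  (forall i, continuous (F i)) -> (forall i, has_mean (F i) (m i)) ->
  has_mean (fun t => \sum_(i <- r | P i) F i t) (\sum_(i <- r | P i) m i).
Proof.
move=> cF Fm; elim: r => [|i r IH].
  rewrite big_nil; under eq_fun do rewrite big_nil; exact: has_mean_cst.
rewrite big_cons; under eq_fun do rewrite big_cons; case: (P i) => //.
by apply: has_meanD => //; exact: continuous_sum.
Qed.

Lemma has_mean_le f g m1 m2 : continuous f -> continuous g ->
  (forall t, f t <= g t) -> has_mean f m1 -> has_mean g m2 -> m1 <= m2.
Proof.
move=> cf cg fg fm gm; apply: (ler_cvg_to fm gm); near=> T.
apply: le_avg => //; near: T; exact: nbhs_pinfty_gt.
Unshelve. all: by end_near. Qed.

(** The averages of [f] inherit the Cauchy property from those of a uniformly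
    close function, so no candidate for the limit is needed. *)
Lemma has_mean_uniform_limit f : continuous f ->
  (forall e, 0 < e -> exists g, [/\ continuous g, exists m, has_mean g m &
     forall t, `|f t - g t| <= e]) ->
  exists m, has_mean f m.
Proof.
move=> cf fg; suff /cvg_ex : cvg (avg f T @[T --> +oo]) by [].
apply/cauchy_cvgP/cauchy_exP => e e0.
have e3 : 0 < e / 3 by rewrite divr_gt0.
have [g [cg [m gm] fge]] := fg _ e3; exists m.
have /cvgrPdist_lt/(_ _ e3) gme := gm.
rewrite /= nbhs_simpl/=; near=> T; rewrite /ball /= .
have T0 : 0 < T by near: T; exact: nbhs_pinfty_gt.
have cfe k : continuous (fun t => g t + k).
  by move=> t; apply: cvgD; [exact: cg|exact: cvg_cst].
have h1 : avg f T <= avg g T + e / 3.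
  rewrite -[X in _ + X](avg_cst _ T0) -avgD//; last exact: cst_continuous.
  by apply: le_avg => // t; have := fge t; rewrite ler_norml; lra.
have h2 : avg g T + - (e / 3) <= avg f T.
  rewrite -[X in _ + X](avg_cst _ T0) -avgD//; last exact: cst_continuous.
  by apply: le_avg => // t; have := fge t; rewrite ler_norml; lra.
have : `|m - avg g T| < e / 3 by near: T.
by rewrite !ltr_norml; lra.
Unshelve. all: by end_near. Qed.

Lemma continuous_cos_affine u v : continuous (fun t : R => cos (u * t + v)).
Proof.
move=> t; apply: (@continuous_comp _ _ _ (fun t => u * t + v) cos).
  by apply: cvgD; [apply: cvgMr; exact: cvg_id|exact: cvg_cst].
exact: continuous_cos.
Qed.

Lemma has_mean_cos u v :
  has_mean (fun t => cos (u * t + v)) (if u == 0 then cos v else 0).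
Proof.
have [->|u0] := eqVneq.
  by under eq_fun do rewrite mul0r add0r; exact: has_mean_cst.
pose F t := u^-1 * sin (u * t + v).
have dF (t : R) : is_derive t 1 F (cos (u * t + v)).
  have -> : cos (u * t + v) = u^-1 *: (cos (u * t + v) * u).
    by rewrite /GRing.scale/= mulrCA mulVf// mulr1.
  apply: is_deriveZ; apply: (@is_derive1_comp _ sin (fun t => u * t + v)).
  rewrite -[X in is_derive _ _ _ X]addr0; apply: is_deriveD.
  by rewrite -[X in is_derive _ _ _ X]mulr1; exact: is_deriveZ.
have cF : continuous F.
  by move=> t; apply/differentiable_continuous/derivable1_diffP; exact: ex_derive.
(* The antiderivative is bounded, so the averages decay like 1 / T. *)
have bound T : 0 < T -> `|avg (fun t => cos (u * t + v)) T| <= `|u|^-1 / T.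
  move=> T0; rewrite /avg /Rintegral (@continuous_FTC2 _ _ F) ?gtrN//; first last.
  - by move=> t _; rewrite derive1E; apply: derive_val.
  - split=> [t _||]; first exact: ex_derive.
      exact/cvg_at_right_filter/cF.
    exact/cvg_at_left_filter/cF.
  - exact/continuous_subspaceT/continuous_cos_affine.
  rewrite /= /F -mulrBr; set d := sin _ - sin _.
  have d2 : `|d| <= 2.
    apply: le_trans (ler_normB _ _) _.
    have := sin_max (u * T + v); have := sin_max (u * - T + v); lra.
  rewrite normrM (normrM u^-1) !normfV (@ger0_norm _ (2 * T)); last lra.
  rewrite mulrCA ler_wpM2l ?invr_ge0// ler_pdivrMl; last lra.
  by rewrite mulfK ?gt_eqF.
apply: norm_cvg0; apply: (@squeeze_cvgr _ _ _ _ (fun=> 0) (fun T => `|u|^-1 / T)).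
- near=> T; rewrite normr_ge0/=; apply: bound; near: T; exact: nbhs_pinfty_gt.
- exact: cvg_cst.
- rewrite -[X in _ --> X](mulr0 `|u|^-1); apply: cvgMr.
  apply/gtr0_cvgV0; last exact: cvg_id.
  exact: nbhs_pinfty_gt.
Unshelve. all: by end_near. Qed.

End MeanValues.

(** * Continuous functions of trigonometric polynomials have mean values *)

Section Weierstrass.
Context {R : realType}.
Implicit Types (f : R -> R) (g h : nat -> R) (x e c : R) (n : nat).

(** The expectation of [g (X_1 + ... + X_n)] for independent Bernoulli
    variables of parameter [x]; for [g k = f (k / n)] this is the Bernstein
    polynomial of [f], and the recursion shows at once that it is a polynomial
    in [x]. *)
Fixpoint bernstein n g x : R :=
  if n is m.+1 then
    x * bernstein m (fun k => g k.+1) x + (1 - x) * bernstein m g x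
  else g 0%N.

Lemma bernstein_cst n c x : bernstein n (fun=> c) x = c.
Proof. by elim: n => //= n ->; ring. Qed.

Lemma bernsteinD n g h x :
  bernstein n (fun k => g k + h k) x = bernstein n g x + bernstein n h x.
Proof. by elim: n g h => //= n IH g h; rewrite !IH; ring. Qed.

Lemma bernsteinZ n c g x :
  bernstein n (fun k => c * g k) x = c * bernstein n g x.
Proof. by elim: n g => //= n IH g; rewrite !IH; ring. Qed.

Lemma le_bernstein n g h x : 0 <= x <= 1 ->
  (forall k, (k <= n)%N -> g k <= h k) -> bernstein n g x <= bernstein n h x.
Proof.
move=> /andP[x0 x1]; elim: n g h => [|n IH] g h gh /=; first exact: gh.
apply: lerD; first by rewrite ler_wpM2l// IH// => k kn; exact: gh.
by rewrite ler_wpM2l ?subr_ge0// IH// => k kn; apply: gh; exact: leqW.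
Qed.

Lemma bernstein_second_moment n c x :
  bernstein n (fun k => (k%:R + c) ^+ 2) x =
  (n%:R * x + c) ^+ 2 + n%:R * x * (1 - x).
Proof.
elim: n c => [|n IH] c /=; first by ring.
have -> : (fun k : nat => (k.+1%:R + c) ^+ 2) =
          (fun k : nat => (k%:R + (1 + c)) ^+ 2).
  by apply/funext => k; rewrite -natr1; ring.
by rewrite !IH -natr1; ring.
Qed.

(** Uniform continuity on [0, 1] in a form whose right-hand side has a computable
    Bernstein average: where [|x - y|] is not small, the quadratic term exceeds
    the oscillation of [f]. *)
Lemma quadratic_modulus f e : continuous f -> 0 < e ->
  exists2 K, 0 <= K & forall x y, 0 <= x <= 1 -> 0 <= y <= 1 ->
    `|f x - f y| <= e + K * (x - y) ^+ 2.
Proof.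
move=> cf e0; have kI := @segment_compact R 0 1.
have [M [_ fM]] : bounded_set (f @` `[0, 1]).
  by apply/compact_bounded/continuous_compact => //; exact: continuous_subspaceT.
have {fM}fM x : 0 <= x <= 1 -> `|f x| <= `|M| + 1.
  move=> x01; apply: (fM (`|M| + 1)); first by have := ler_norm M; lra.
  by exists x => //; rewrite /= in_itv.
have local (x : R) : \forall z \near x & d \near (0 : R)^'+,
    forall y, `|z - y| < d -> `|f z - f y| < e.
  have e2 : 0 < e / 2 by rewrite divr_gt0.
  have /cvgrPdist_lt/(_ _ e2)/nbhs_ballP[d /= d0 fd] := cf x.
  have d2 : 0 < d / 2 by rewrite divr_gt0.
  exists (ball x (d / 2), [set r | 0 < r < d / 2]) => /=.
    split; first exact: nbhsx_ballx.
    by near=> r; rewrite /=; apply/andP; split; near: r;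
      [exact: nbhs_right_gt|exact: nbhs_right_lt].
  move=> [z r] [/= xz /andP[r0 rd]] y zy.
  have {}xz : `|x - z| < d / 2 := xz.
  have {}fd w : `|x - w| < d -> `|f x - f w| < e / 2 by move=> xw; exact: fd.
  have fz : `|f x - f z| < e / 2 by apply: fd; lra.
  have fy : `|f x - f y| < e / 2.
    by apply: fd; have := ler_distD z x y; lra.
  by have := ler_distD (f x) (f z) (f y); rewrite (distrC (f z) (f x)); lra.
have /compact_near_coveringP/(_ R (0^'+) (fun d x =>
  forall y, `|x - y| < d -> `|f x - f y| < e)
  _ (fun x _ => local x)) modulus := kI.
have [d [d0 fd]] : exists d : R, 0 < d /\
    forall x, [set` `[0, 1]] x -> forall y, `|x - y| < d -> `|f x - f y| < e.
  near (0 : R)^'+ => d; exists d; split; last by near: d.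
  by near: d; exact: nbhs_right_gt.
exists (2 * (`|M| + 1) / d ^+ 2) => [|x y x01 y01].
  by rewrite divr_ge0 ?sqr_ge0// mulr_ge0// addr_ge0.
have [xy|dxy] := ltP `|x - y| d.
  apply: (@le_trans _ _ e); first by apply/ltW/fd => //; rewrite /= in_itv.
  rewrite lerDl mulr_ge0 ?sqr_ge0// divr_ge0 ?sqr_ge0// mulr_ge0// addr_ge0//.
apply: (@le_trans _ _ (2 * (`|M| + 1))).
  by apply: le_trans (ler_normB _ _) _; have := fM _ x01; have := fM _ y01; lra.
apply: (@le_trans _ _ (2 * (`|M| + 1) / d ^+ 2 * (x - y) ^+ 2)); last lra.
rewrite -mulrA ler_peMr ?mulr_ge0 ?addr_ge0//.
rewrite mulrC ler_pdivlMr ?exprn_gt0// mul1r -(real_normK (num_real (x - y))).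
by rewrite lerXn2r// nnegrE ?ltW.
Unshelve. all: by end_near. Qed.

(** Chebyshev's form of Bernstein's proof: the quadratic modulus turns the
    error into the variance [x (1 - x) / n]. *)
Lemma bernstein_approximation f e : continuous f -> 0 < e ->
  exists n, forall x, 0 <= x <= 1 ->
    `|f x - bernstein n (fun k => f (k%:R / n%:R)) x| <= e.
Proof.
move=> cf e0; have e2 : 0 < e / 2 by rewrite divr_gt0.
have [K K0 fK] := quadratic_modulus cf e2.
pose n := (Num.bound (K / (e / 2))).+1; exists n => x x01.
have n0 : (0 : R) < n%:R by rewrite ltr0n.
have Kn : K / n%:R <= e / 2.
  rewrite ler_pdivrMr// mulrC -ler_pdivrMr//.
  apply: le_trans (ltW (archi_boundP _)) _; first by rewrite divr_ge0// ltW.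
  by rewrite ler_nat.
pose q (k : nat) := e / 2 + K / n%:R ^+ 2 * (k%:R + - (n%:R * x)) ^+ 2.
have Eq : bernstein n q x <= e.
  rewrite bernsteinD bernstein_cst bernsteinZ bernstein_second_moment addrN.
  have -> : K / n%:R ^+ 2 * (0 ^+ 2 + n%:R * x * (1 - x)) =
            K / n%:R * (x * (1 - x)) by field; rewrite gt_eqF.
  have : 0 <= K / n%:R by rewrite divr_ge0// ltW.
  have : x * (1 - x) <= 1 by nra.
  nra.
have fq k : (k <= n)%N -> `|f x - f (k%:R / n%:R)| <= q k.
  move=> kn; have -> : q k = e / 2 + K * (x - k%:R / n%:R) ^+ 2.
    by rewrite /q; field; rewrite gt_eqF.
  apply: fK => //; apply/andP; split; first exact: divr_ge0.
  by rewrite ler_pdivrMr// mul1r ler_nat.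
have split_f : f x - bernstein n (fun k => f (k%:R / n%:R)) x =
    bernstein n (fun k => f x + -1 * f (k%:R / n%:R)) x.
  by rewrite bernsteinD bernstein_cst bernsteinZ mulN1r.
rewrite split_f ler_norml; apply/andP; split.
  apply: (@le_trans _ _ (bernstein n (fun k => -1 * q k) x)).
    by rewrite bernsteinZ; lra.
  by apply: le_bernstein => // k /fq; rewrite ler_norml; lra.
apply: le_trans Eq; apply: le_bernstein => // k /fq; rewrite ler_norml; lra.
Qed.

End Weierstrass.

Section TrigonometricPolynomials.
Context {R : realType}.
Implicit Types (f g : R -> R).

Inductive trigpoly : (R -> R) -> Prop :=
| trigpoly0 : trigpoly (fun=> 0)
| trigpoly_cons a u v f :
    trigpoly f -> trigpoly (fun t => a * cos (u * t + v) + f t).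

Lemma trigpolyD f g : trigpoly f -> trigpoly g -> trigpoly (fun t => f t + g t).
Proof.
move=> tf tg; elim: tf => [|a u v h _ IH].
  by under eq_fun do rewrite add0r.
by under eq_fun do rewrite -addrA; exact: trigpoly_cons.
Qed.

Lemma trigpoly_cos a u v : trigpoly (fun t => a * cos (u * t + v)).
Proof.
have -> : (fun t => a * cos (u * t + v)) = (fun t => a * cos (u * t + v) + 0).
  by apply/funext => t; rewrite addr0.
by apply: trigpoly_cons; exact: trigpoly0.
Qed.

Lemma trigpoly_sin a u v : trigpoly (fun t => a * sin (u * t + v)).
Proof.
under eq_fun do rewrite -cosBpihalf -addrA; exact: trigpoly_cos.
Qed.

Lemma trigpoly_cst c : trigpoly (fun=> c).
Proof.
have := trigpoly_cos c 0 0.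
by under eq_fun do rewrite mul0r addr0 cos0 mulr1.
Qed.

Lemma trigpolyM f g : trigpoly f -> trigpoly g -> trigpoly (fun t => f t * g t).
Proof.
move=> tf tg; elim: tf => [|a u v h _ IH].
  by under eq_fun do rewrite mul0r; exact: trigpoly0.
under eq_fun do rewrite mulrDl; apply: trigpolyD => // {h IH}.
elim: tg => [|b w z h _ IH].
  by under eq_fun do rewrite mulr0; exact: trigpoly0.
under eq_fun do rewrite mulrDr; apply: trigpolyD => //.
have -> : (fun t => a * cos (u * t + v) * (b * cos (w * t + z))) =
    (fun t => a * b / 2 * cos ((u + w) * t + (v + z)) +
              a * b / 2 * cos ((u - w) * t + (v - z))).
  apply/funext => t.
  have -> : (u + w) * t + (v + z) = (u * t + v) + (w * t + z) by ring.
  have -> : (u - w) * t + (v - z) = (u * t + v) - (w * t + z) by ring.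
  by move: (u * t + v) (w * t + z) => x y; rewrite cosD cosB; field.
by apply: trigpolyD; exact: trigpoly_cos.
Qed.

Lemma trigpolyZ c f : trigpoly f -> trigpoly (fun t => c * f t).
Proof. by apply: trigpolyM; exact: trigpoly_cst. Qed.

Lemma trigpoly_sum (I : Type) (r : seq I) (F : I -> R -> R) :
  (forall i, trigpoly (F i)) -> trigpoly (fun t => \sum_(i <- r) F i t).
Proof.
move=> tF; elim: r => [|i r IH].
  by under eq_fun do rewrite big_nil; exact: trigpoly0.
by under eq_fun do rewrite big_cons; exact: trigpolyD.
Qed.

Lemma trigpoly_bernstein n (c : nat -> R) f :
  trigpoly f -> trigpoly (fun t => bernstein n c (f t)).
Proof.
move=> tf; elim: n c => [|n IH] c /=; first exact: trigpoly_cst.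
apply: trigpolyD; first exact: trigpolyM.
apply: trigpolyM => //; apply: trigpolyD; first exact: trigpoly_cst.
by under eq_fun do rewrite -mulN1r; exact: trigpolyZ.
Qed.

Lemma trigpoly_continuous f : trigpoly f -> continuous f.
Proof.
elim=> [|a u v h _ ch] t; first exact: cst_continuous.
apply: cvgD; last exact: ch.
by apply: cvgMr; exact: continuous_cos_affine.
Qed.

Lemma trigpoly_bounded f : trigpoly f ->
  exists2 M, 0 < M & forall t, `|f t| <= M.
Proof.
elim=> [|a u v h _ [M M0 hM]]; first by exists 1 => // t; rewrite normr0.
exists (`|a| + M) => [|t]; first exact: ltr_wpDl.
apply: le_trans (ler_normD _ _) _; apply: lerD => //.
by rewrite normrM ler_piMr// cos_max.
Qed.

Lemma trigpoly_has_mean f : trigpoly f -> exists m, has_mean f m.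
Proof.
elim=> [|a u v h th [m hm]]; first by exists 0; exact: has_mean_cst.
exists (a * (if u == 0 then cos v else 0) + m); apply: has_meanD => //.
- exact/trigpoly_continuous/trigpoly_cos.
- exact: trigpoly_continuous.
- by apply: has_meanZ; [exact: continuous_cos_affine|exact: has_mean_cos].
Qed.

(** After an affine change of variable the values of [f] lie in [0, 1], where
    Bernstein polynomials approximate [phi] uniformly; they keep
    trigonometric polynomials trigonometric. *)
Lemma has_mean_comp_trigpoly (phi : R -> R) f : continuous phi -> trigpoly f ->
  exists m, has_mean (fun t => phi (f t)) m.
Proof.
move=> cphi tf; have cf := trigpoly_continuous tf.
apply: has_mean_uniform_limit.
  by move=> t; apply: continuous_comp; [exact: cf|exact: cphi].
move=> e e0; have [M M0 fM] := trigpoly_bounded tf.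
pose psi x := phi (2 * M * x - M).
have cpsi : continuous psi.
  move=> x; apply: (@continuous_comp _ _ _ (fun x => 2 * M * x - M) phi).
    by apply: cvgB; [apply: cvgMr; exact: cvg_id|exact: cvg_cst].
  exact: cphi.
have [n psin] := bernstein_approximation cpsi e0.
pose f01 t := (2 * M)^-1 * f t + 2^-1.
have tf01 : trigpoly f01.
  by apply: trigpolyD; [exact: trigpolyZ|exact: trigpoly_cst].
have tB := trigpoly_bernstein n (fun k => psi (k%:R / n%:R)) tf01.
exists (fun t => bernstein n (fun k => psi (k%:R / n%:R)) (f01 t)); split.
- exact: trigpoly_continuous.
- exact: trigpoly_has_mean.
- move=> t; have -> : phi (f t) = psi (f01 t).
    by rewrite /psi /f01; congr phi; field; rewrite gt_eqF.
  apply: psin; rewrite /f01; have := fM t; rewrite ler_norml => /andP[f1 f2].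
  have -> : (2 * M)^-1 * f t + 2^-1 = (f t + M) / (2 * M).
    by field; rewrite gt_eqF.
  by rewrite ler_pdivrMr ?ler_pdivlMr ?mulr_gt0// mul0r mul1r; lra.
Qed.

End TrigonometricPolynomials.

Lemma continuous_norm_powR {R : realType} (q : R) : 0 < q ->
  continuous (fun x : R => `|x| `^ q).
Proof.
move=> q0 x; have [->|x0] := eqVneq x 0; last first.
  apply: (@continuous_comp _ _ _ (fun x : R => `|x|) (fun x => x `^ q)).
    exact: norm_continuous.
  apply/differentiable_continuous/derivable1_diffP/derivable_powR.
  by rewrite in_itv/= andbT normr_gt0.
apply/cvgrPdist_lt => e e0; rewrite /= normr0 powR0 ?gt_eqF//.
near=> y; rewrite sub0r normrN ger0_norm ?powR_ge0//.
have -> : e = (e `^ q^-1) `^ q.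
  by rewrite -powRrM mulVf ?gt_eqF// powRr1// ltW.
apply: gt0_ltr_powR => //; rewrite ?nnegrE ?powR_ge0//.
near: y; apply/nbhs_ballP; exists (e `^ q^-1) => /=; first exact: powR_gt0.
by move=> y; rewrite /ball/= sub0r normrN.
Unshelve. all: by end_near. Qed.

(** * Norms of Dirichlet polynomials *)

Section DirichletPolynomials.
Context {R : realType}.
Implicit Types (lam : nat -> R) (D : dirichlet_poly R) (t p : R).

Lemma dirichlet_evalE n lam D t : (size D <= n)%N ->
  dirichlet_eval lam D (0 +i* t) =
  \sum_(i < n) D`_i * (cos (lam i * t) +i* - sin (lam i * t)).
Proof.
move=> Dn; rewrite /dirichlet_eval.
rewrite (big_ord_widen n (fun i => D`_i * cexp (- (lam i)%:C * (0 +i* t))))//.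
rewrite big_mkcond/=; apply: eq_bigr => i _; case: ltnP => [_|Di].
  rewrite /cexp/=; congr (_ * _).
  rewrite oppr0 !mul0r mulr0 subr0 addr0 expR0 mulNr cosN sinN.
  exact: mul1r.
by rewrite nth_default// mul0r.
Qed.

Definition dirichlet_Re n lam D t :=
  \sum_(i < n) (complex.Re D`_i * cos (lam i * t) +
                complex.Im D`_i * sin (lam i * t)).

Definition dirichlet_Im n lam D t :=
  \sum_(i < n) (complex.Im D`_i * cos (lam i * t) -
                complex.Re D`_i * sin (lam i * t)).

Lemma dirichlet_abs_sqr n lam D t : (size D <= n)%N ->
  dirichlet_abs lam D t ^+ 2 =
  dirichlet_Re n lam D t ^+ 2 + dirichlet_Im n lam D t ^+ 2.
Proof.
move=> Dn; rewrite /dirichlet_abs normc_sqr (dirichlet_evalE lam t Dn).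
rewrite Re_sum Im_sum; congr (_ ^+ 2 + _ ^+ 2); apply: eq_bigr => i _.
  by case: D`_i => a b/=; ring.
by case: D`_i => a b/=; ring.
Qed.

Lemma dirichlet_abs_ge0 lam D t : 0 <= dirichlet_abs lam D t.
Proof. by rewrite /dirichlet_abs; case: dirichlet_eval => a b; exact: sqrtr_ge0. Qed.

Lemma trigpoly_dirichlet_abs_sqr lam D :
  trigpoly (fun t => dirichlet_abs lam D t ^+ 2).
Proof.
under eq_fun do rewrite (dirichlet_abs_sqr lam _ (leqnn _)) !expr2.
have tcos (c u : R) : trigpoly (fun t => c * cos (u * t)).
  by have := trigpoly_cos c u 0; under eq_fun do rewrite addr0.
have tsin (c u : R) : trigpoly (fun t => c * sin (u * t)).
  by have := trigpoly_sin c u 0; under eq_fun do rewrite addr0.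
have tRe : trigpoly (dirichlet_Re (size D) lam D).
  by apply: trigpoly_sum => i; exact: trigpolyD.
have tIm : trigpoly (dirichlet_Im (size D) lam D).
  apply: trigpoly_sum => i; under eq_fun do rewrite -mulNr.
  exact: trigpolyD.
by apply: trigpolyD; exact: trigpolyM.
Qed.

Lemma dirichlet_abs_powR lam D t p :
  dirichlet_abs lam D t `^ p = `|dirichlet_abs lam D t ^+ 2| `^ (p / 2).
Proof.
rewrite ger0_norm ?sqr_ge0// -powR_mulrn ?dirichlet_abs_ge0//.
by rewrite -powRrM mulrC divfK.
Qed.

Lemma continuous_dirichlet_abs_powR lam D p : 0 < p ->
  continuous (fun t => dirichlet_abs lam D t `^ p).
Proof.
move=> p0; under eq_fun do rewrite dirichlet_abs_powR.
move=> t; apply: (@continuous_comp _ _ _ (fun t => dirichlet_abs lam D t ^+ 2)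
  (fun x => `|x| `^ (p / 2))).
  exact/trigpoly_continuous/trigpoly_dirichlet_abs_sqr.
by apply: continuous_norm_powR; rewrite divr_gt0.
Qed.

(** The averages of [|D|^p] converge because [|D|^p] is the continuous function
    [x |-> |x|^(p/2)] of the trigonometric polynomial [|D|^2]; if they did not,
    [lim] would carry no information about them. *)
Lemma has_mean_norm_Hp lam p D : 0 < p ->
  has_mean (fun t => dirichlet_abs lam D t `^ p) (norm_Hp lam p D `^ p) /\
  0 <= norm_Hp lam p D.
Proof.
move=> p0; have [m Dm] : exists m,
    has_mean (fun t => dirichlet_abs lam D t `^ p) m.
  rewrite (funext (fun t => dirichlet_abs_powR lam D t p)).
  apply: (@has_mean_comp_trigpoly _ (fun x => `|x| `^ (p / 2)) _ _
    (trigpoly_dirichlet_abs_sqr lam D)).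
  by apply: continuous_norm_powR; rewrite divr_gt0.
have m0 : 0 <= m.
  apply: (@has_mean_le _ (fun=> 0) _ 0 m _ _ _ _ Dm).
  - exact: cst_continuous.
  - exact: continuous_dirichlet_abs_powR.
  - by move=> t; exact: powR_ge0.
  - exact: has_mean_cst.
have -> : norm_Hp lam p D = m `^ p^-1; last first.
  by rewrite -powRrM mulVf ?gt_eqF// powRr1// powR_ge0.
apply: cvg_lim => //; rewrite -[in X in _ --> X](ger0_norm m0).
have := cvg_comp _ _ Dm (@continuous_norm_powR R p^-1 _ m).
rewrite invr_gt0 => /(_ p0); apply: cvg_trans; apply: near_eq_cvg.
near=> T; rewrite /= -/(avg _ T) ger0_norm//.
rewrite -(@avg_cst R 0 T); last by near: T; exact: nbhs_pinfty_gt.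
apply: le_avg.
- exact: cst_continuous.
- exact: continuous_dirichlet_abs_powR.
- by near: T; exact: nbhs_pinfty_gt.
- by move=> t; exact: powR_ge0.
Unshelve. all: by end_near. Qed.

Definition l2_sqr D := \sum_(i < size D) Normc.normc D`_i ^+ 2.

(** The product of two exponentials has mean value 1 or 0 according to whether
    their frequencies agree, so that only the diagonal of the double sum
    survives. *)
Lemma has_mean_dirichlet_abs_sqr lam D : injective lam ->
  has_mean (fun t => dirichlet_abs lam D t ^+ 2) (l2_sqr D).
Proof.
move=> lam_inj; set n := size D.
(* [A] and [B] are the real and the imaginary part of the product of [D`_i]
   with the conjugate of [D`_j]; the phase [pi / 2] writes the sine as a
   cosine. *)
pose A (i j : nat) := complex.Re D`_i * complex.Re D`_j +
                      complex.Im D`_i * complex.Im D`_j.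
pose B (i j : nat) := complex.Im D`_i * complex.Re D`_j -
                      complex.Re D`_i * complex.Im D`_j.
pose F (i j : 'I_n) t := A i j * cos ((lam i - lam j) * t + 0) +
                 B i j * cos ((lam i - lam j) * t + - (pi / 2)).
pose m (i j : 'I_n) := A i j * (if lam i - lam j == 0 then cos 0 else 0) +
  B i j * (if lam i - lam j == 0 then cos (- (pi / 2)) else 0).
have -> : (fun t => dirichlet_abs lam D t ^+ 2) =
          (fun t => \sum_i \sum_j F i j t).
  apply/funext => t; rewrite (dirichlet_abs_sqr lam _ (leqnn n)) !expr2.
  rewrite /dirichlet_Re /dirichlet_Im !mulr_suml -big_split/=.
  apply: eq_bigr => i _; rewrite !mulr_sumr -big_split/=; apply: eq_bigr => j _.
  by rewrite /F /A /B addr0 cosBpihalf (mulrBl t (lam i)) cosB sinB; ring.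
have -> : l2_sqr D = \sum_i \sum_j m i j.
  apply: eq_bigr => i _; rewrite (bigD1 i)//= big1 ?addr0.
    by rewrite /m /A subrr eqxx cosN cos_pihalf cos0 mulr1 mulr0 addr0 normc_sqr.
  move=> j ij; suff /negPf lam_ij : lam i - lam j != 0.
    by rewrite /m lam_ij !mulr0 addr0.
  by rewrite subr_eq0; apply: contraNneq ij => /lam_inj/ord_inj ->.
have cF i j : continuous (F i j).
  apply: trigpoly_continuous; apply: trigpolyD; exact: trigpoly_cos.
apply: has_mean_sum => i; first exact: continuous_sum.
apply: has_mean_sum => j //.
apply: has_meanD.
- exact/trigpoly_continuous/trigpoly_cos.
- exact/trigpoly_continuous/trigpoly_cos.
- by apply: has_meanZ; [exact: continuous_cos_affine|exact: has_mean_cos].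
- by apply: has_meanZ; [exact: continuous_cos_affine|exact: has_mean_cos].
Qed.

Lemma norm_H2_sqr lam D : injective lam -> norm_Hp lam 2 D ^+ 2 = l2_sqr D.
Proof.
move=> lam_inj; have [D2 D0] := has_mean_norm_Hp lam D (ltr0Sn R 1).
rewrite -powR_mulrn//; apply: has_mean_unique D2 _.
under eq_fun do rewrite powR_mulrn ?dirichlet_abs_ge0//.
exact: has_mean_dirichlet_abs_sqr.
Qed.

End DirichletPolynomials.

(** * Rademacher averages *)

Section Rademacher.
Context {R : realType}.

Definition rademacher (I : finType) (x : I -> R) (s : {ffun I -> bool}) : R :=
  \sum_i (-1) ^+ s i * x i.

(** The sharp constant in the exponent is 1/2; with 2 the claim follows from
    [exp z <= 1 / (1 - z) <= 1 + z + 2 z ^ 2]. *)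
Lemma cosh_le_gaussian (y : R) : `|y| <= 2^-1 ->
  expR y + expR (- y) <= 2 * expR (2 * y ^+ 2).
Proof.
have half (z : R) : z <= 2^-1 -> expR z <= 1 + z + 2 * z ^+ 2.
  move=> z2; have z1 : 0 < 1 - z by lra.
  have le1 : expR z <= (1 - z)^-1.
    rewrite -[expR z]invrK -expRN lef_pV2 ?posrE ?expR_gt0//.
    exact: expR_ge1Dx.
  apply: le_trans le1 _; rewrite -[leLHS]mul1r ler_pdivrMr//.
  have : 0 <= z ^+ 2 * (1 - 2 * z) by rewrite mulr_ge0 ?sqr_ge0//; lra.
  rewrite !expr2; lra.
rewrite ler_norml => /andP[y1 y2].
have h1 := half y y2; have h2 : expR (- y) <= 1 + - y + 2 * (- y) ^+ 2.
  by apply: half; lra.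
rewrite sqrrN in h2; have := expR_ge1Dx (2 * y ^+ 2); lra.
Qed.

(** By independence the expectation of the product is the product of the
    expectations, here the distributivity of product over sum. *)
Lemma rademacher_exp (I : finType) (x : I -> R) : (forall i, `|x i| <= 2^-1) ->
  \sum_s expR (rademacher x s) <= 2 ^+ #|I| * expR (2 * \sum_i x i ^+ 2).
Proof.
move=> x2; pose F i (b : bool) := expR ((-1) ^+ b * x i).
have -> : \sum_s expR (rademacher x s) = \prod_i \sum_b F i b.
  by rewrite bigA_distr_bigA; apply: eq_bigr => s _; rewrite expR_sum.
apply: (@le_trans _ _ (\prod_i (2 * expR (2 * x i ^+ 2)))).
  apply: ler_prod => i _; rewrite sumr_ge0 => [/=|b _]; last exact: expR_ge0.
  rewrite big_bool/= /F expr1 expr0 mul1r mulN1r addrC; exact: cosh_le_gaussian.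
by rewrite big_split/= prodr_const -expR_sum mulr_sumr.
Qed.

Lemma expR_norm2_le (u v : R) : expR (`|u| + `|v|) <=
  expR (u + v) + expR (u - v) + (expR (- u + v) + expR (- u - v)).
Proof.
have := expR_ge0 (u + v); have := expR_ge0 (u - v).
have := expR_ge0 (- u + v); have := expR_ge0 (- u - v).
by case: (ler0P u) => _; case: (ler0P v) => _; lra.
Qed.

(** The four sign patterns of [expR_norm2_le] reduce the modulus of a complex
    Rademacher sum to real sums, and the factor 1/4 keeps their coefficients
    in the range of [cosh_le_gaussian]. *)
Lemma rademacher_exp_norm (I : finType) (x y : I -> R) :
  \sum_i (x i ^+ 2 + y i ^+ 2) <= 1 ->
  \sum_s expR (`|rademacher x s / 4| + `|rademacher y s / 4|) <=
  2 ^+ #|I| * (4 * expR 1).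
Proof.
move=> xy1; have xy i : x i ^+ 2 + y i ^+ 2 <= 1.
  apply: le_trans xy1; rewrite (bigD1 i)//= lerDl sumr_ge0// => j _.
  by rewrite addr_ge0 ?sqr_ge0.
have signs (a b : R) : a ^+ 2 = 1 -> b ^+ 2 = 1 ->
    \sum_s expR (a * (rademacher x s / 4) + b * (rademacher y s / 4)) <=
    2 ^+ #|I| * expR 1.
  move=> a1 b1; pose z i := (a * x i + b * y i) / 4.
  have zE s : a * (rademacher x s / 4) + b * (rademacher y s / 4) =
      rademacher z s.
    rewrite /rademacher !mulr_suml !mulr_sumr -big_split/=.
    by apply: eq_bigr => i _; rewrite /z; field.
  have z2 i : z i ^+ 2 <= (x i ^+ 2 + y i ^+ 2) / 8.
    have -> : z i ^+ 2 = (a ^+ 2 * x i ^+ 2 * 2 + b ^+ 2 * y i ^+ 2 * 2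
        - (a * x i - b * y i) ^+ 2) / 16 by rewrite /z; field.
    rewrite a1 b1; have := sqr_ge0 (a * x i - b * y i); lra.
  under eq_bigr do rewrite zE; apply: le_trans (rademacher_exp _) _ => [i|].
    rewrite -(@ler_pXn2r _ 2)// ?nnegrE ?normr_ge0 ?invr_ge0//.
    rewrite real_normK ?num_real//; have := z2 i; have := xy i; rewrite !expr2; lra.
  rewrite ler_wpM2l ?exprn_ge0// ler_expR.
  have : \sum_i z i ^+ 2 <= (\sum_i (x i ^+ 2 + y i ^+ 2)) / 8.
    by rewrite mulr_suml; apply: ler_sum.
  lra.
pose E a b s := expR (a * (rademacher x s / 4) + b * (rademacher y s / 4)).
apply: (@le_trans _ _ (\sum_s (E 1 1 s + E 1 (-1) s + (E (-1) 1 s +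
    E (-1) (-1) s)))).
  by apply: ler_sum => s _; rewrite /E !mul1r !mulN1r; exact: expR_norm2_le.
rewrite !big_split/=.
have N1 : (-1) ^+ 2 = 1 :> R by rewrite sqrrN expr1n.
have := signs 1 1 (expr1n _ _) (expr1n _ _); have := signs 1 (-1) (expr1n _ _) N1.
have := signs (-1) 1 N1 (expr1n _ _); have := signs (-1) (-1) N1 N1.
rewrite -/(E _ _) /E; lra.
Qed.

(** [K] comes from [x ^ k <= k! * exp x] at [x = r s / 4].  It does not depend
    on the number of terms. *)
Lemma rademacher_moment k : exists2 K : R, 0 < K &
  forall (I : finType) (x y : I -> R) (r : {ffun I -> bool} -> R),
    \sum_i (x i ^+ 2 + y i ^+ 2) <= 1 ->
    (forall s, 0 <= r s) ->
    (forall s, r s ^+ 2 = rademacher x s ^+ 2 + rademacher y s ^+ 2) ->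
  \sum_s r s ^+ k.+1 <= 2 ^+ #|I| * K.
Proof.
exists (4 ^+ k.+1 * k.+1`!%:R * (4 * expR 1)).
  by rewrite !mulr_gt0 ?exprn_gt0 ?ltr0n ?fact_gt0 ?expR_gt0.
move=> I x y r xy1 r0 rE.
apply: le_trans (_ : _ <= \sum_s 4 ^+ k.+1 * k.+1`!%:R *
    expR (`|rademacher x s / 4| + `|rademacher y s / 4|)) _; last first.
  rewrite -mulr_sumr mulrCA ler_wpM2l ?mulr_ge0 ?exprn_ge0//.
  exact: rademacher_exp_norm.
apply: ler_sum => s _.
have rxy : r s / 4 <= `|rademacher x s / 4| + `|rademacher y s / 4|.
  rewrite !normrM [`|4^-1|]ger0_norm// -mulrDl ler_wpM2r//.
  exact: le_add_norm_of_sqr.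
have r4 : 0 <= r s / 4 by rewrite divr_ge0.
have := expR_ge1Dxn k r4 => le1.
have {}le1 : (r s / 4) ^+ k.+1 / k.+1`!%:R <= expR (r s / 4) by lra.
have -> : r s ^+ k.+1 = 4 ^+ k.+1 * k.+1`!%:R *
    ((r s / 4) ^+ k.+1 / k.+1`!%:R).
  rewrite expr_div_n; field; rewrite pnatr_eq0 -lt0n fact_gt0/=.
  by rewrite expf_neq0.
rewrite ler_wpM2l ?mulr_ge0 ?exprn_ge0//; apply: le_trans le1 _.
by rewrite ler_expR.
Qed.

(** Interpolation of the second moment between the [p]-th and the fourth: with
    the fourth moment below [K] and the second equal to 1, the last two terms
    absorb at most one half. *)
Lemma sqr_le_powR_quartic (p K : R) : 1 <= p -> 0 < K -> exists2 L : R, 0 < L &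
  forall y : R, 0 <= y -> y ^+ 2 <= L * y `^ p + (4 * K)^-1 * y ^+ 4 + 4^-1.
Proof.
move=> p1 K0; have p2 : 0 < 2 `^ p :> R by exact: powR_gt0.
(* The three summands serve [1 < y <= L], [1 / 2 < y <= 1] and [L < y]; for
   [y <= 1 / 2] the constant 1 / 4 suffices. *)
exists (1 + 2 `^ p + 4 * K) => [|y y0]; first lra.
set L := 1 + _ + _.
have yp : 0 <= y `^ p by exact: powR_ge0.
have y4 : 0 <= (4 * K)^-1 * y ^+ 4.
  by rewrite mulr_ge0 ?exprn_ge0// invr_ge0; lra.
have Lyp : 0 <= L * y `^ p by rewrite mulr_ge0// /L; lra.
have [y2|y2] := leP y 2^-1.
  have : y ^+ 2 <= 4^-1 by rewrite expr2; nra.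
  lra.
have [y1|y1] := leP y 1.
  have : 1 <= L * y `^ p.
    apply: (@le_trans _ _ (2 `^ p * y `^ p)); last by rewrite ler_wpM2r// /L; lra.
    have y21 : 1 <= 2 * y by lra.
    by rewrite -powRM//; apply: le_trans (le1r_powR y21 p1).
  have : y ^+ 2 <= 1 by rewrite exprn_ile1.
  lra.
have [yL|yL] := leP y L.
  have : y ^+ 2 <= L * y `^ p.
    rewrite expr2 ler_pM//; exact/le1r_powR/p1/ltW.
  lra.
have : y ^+ 2 <= (4 * K)^-1 * y ^+ 4.
  rewrite mulrC ler_pdivlMr; last lra.
  rewrite [y ^+ 4](_ : _ = y ^+ 2 * y ^+ 2); last by rewrite -exprD.
  rewrite ler_wpM2l ?sqr_ge0//; rewrite /L in yL; rewrite expr2; nra.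
lra.
Qed.

End Rademacher.

(** * Multipliers and the Hilbert norm *)

Section Multipliers.
Context {R : realType}.
Implicit Types (lam : nat -> R) (D : dirichlet_poly R) (t p C : R)
  (a : nat -> R[i]) (N : dirichlet_poly R -> R).

Definition coef_mult a D : dirichlet_poly R := \poly_(i < size D) (a i * D`_i).

Definition multiplier_bound N C := forall a, (forall n, Normc.normc (a n) <= 1) ->
  forall D, N (coef_mult a D) <= C * N D.

Lemma coef_coef_mult a D i : (coef_mult a D)`_i = a i * D`_i.
Proof.
by rewrite coef_poly; case: ltnP => // Di; rewrite [D`_i]nth_default// mulr0.
Qed.

Lemma l2_sqrE n D : (size D <= n)%N ->
  l2_sqr D = \sum_(i < n) Normc.normc D`_i ^+ 2.
Proof.
move=> Dn; rewrite /l2_sqr.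
rewrite (big_ord_widen n (fun i => Normc.normc D`_i ^+ 2))// big_mkcond/=.
apply: eq_bigr => i _; case: ltnP => // Di.
by rewrite nth_default// Normc.normc0 expr0n.
Qed.

Lemma l2_sqr_mult_le a D : (forall n, Normc.normc (a n) <= 1) ->
  l2_sqr (coef_mult a D) <= l2_sqr D.
Proof.
move=> a1; rewrite (@l2_sqrE (size D)) ?size_poly//; apply: ler_sum => i _.
rewrite coef_coef_mult ler_pXn2r ?nnegrE ?normc_ge0//.
exact: normc_mult_le.
Qed.

(** Extended by 1 beyond the first [n] indices, because multipliers are infinite
    sequences. *)
Definition signs n (s : {ffun 'I_n -> bool}) (j : nat) : R[i] :=
  (-1) ^+ (if insub j is Some i then s i else false).

Lemma signsE n (s : {ffun 'I_n -> bool}) (i : 'I_n) : signs s i = (-1) ^+ s i.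
Proof. by rewrite /signs valK. Qed.

Lemma normc_signs n (s : {ffun 'I_n -> bool}) j : Normc.normc (signs s j) <= 1.
Proof.
rewrite /signs; case: insubP => [i _ _|_]; last by rewrite expr0 Normc.normc1.
by case: (s i); rewrite ?expr1 ?expr0 ?normcN Normc.normc1.
Qed.

Lemma coef_mult_signsK n (s : {ffun 'I_n -> bool}) D :
  coef_mult (signs s) (coef_mult (signs s) D) = D.
Proof.
apply/polyP => i; rewrite !coef_coef_mult mulrA -expr2 /signs sqrr_sign.
by rewrite mul1r.
Qed.

Lemma dirichlet_abs_signs_sqr lam D t (s : {ffun 'I_(size D) -> bool}) :
  dirichlet_abs lam (coef_mult (signs s) D) t ^+ 2 =
  rademacher (fun i : 'I_(size D) => complex.Re D`_i * cos (lam i * t) +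
                complex.Im D`_i * sin (lam i * t)) s ^+ 2 +
  rademacher (fun i : 'I_(size D) => complex.Im D`_i * cos (lam i * t) -
                complex.Re D`_i * sin (lam i * t)) s ^+ 2.
Proof.
rewrite (@dirichlet_abs_sqr _ (size D)) ?size_poly//.
rewrite /dirichlet_Re /dirichlet_Im /rademacher.
congr (_ ^+ 2 + _ ^+ 2); apply: eq_bigr => i _; rewrite coef_coef_mult signsE.
  by case: (s i); case: D`_i => u v /=; ring.
by case: (s i); case: D`_i => u v /=; ring.
Qed.

Lemma dirichlet_abs_signs_moment k : exists2 K : R, 0 < K &
  forall lam D t, l2_sqr D = 1 ->
    \sum_(s : {ffun 'I_(size D) -> bool})
      dirichlet_abs lam (coef_mult (signs s) D) t ^+ k.+1 <=
    2 ^+ size D * K.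
Proof.
have [K K0 rK] := @rademacher_moment R k; exists K => // lam D t D1.
rewrite -[X in 2 ^+ X]card_ord; apply: rK => [||s]; last first.
- exact: dirichlet_abs_signs_sqr.
- by move=> s; exact: dirichlet_abs_ge0.
rewrite -D1; apply: ler_sum => i _; rewrite normc_sqr.
have := cos2Dsin2 (lam i * t); set c := cos _; set v := sin _ => cv.
have -> : complex.Re D`_i ^+ 2 + complex.Im D`_i ^+ 2 =
  (complex.Re D`_i ^+ 2 + complex.Im D`_i ^+ 2) * (c ^+ 2 + v ^+ 2).
  by rewrite cv mulr1.
by rewrite le_eqVlt; apply/orP; left; apply/eqP; ring.
Qed.

Lemma sum_signs_cst n (c : R) : \sum_(s : {ffun 'I_n -> bool}) c = 2 ^+ n * c.
Proof.
by rewrite sumr_const card_ffun card_bool card_ord -[LHS]mulr_natl natrX.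
Qed.

(** Khinchine's inequality: averaging [|sum_n +- a_n e^(-i lambda_n t)|^p]
    over the signs and over [t] gives a quantity comparable with 1, whereas
    multiplier boundedness makes each of these sign changes cost at most a
    factor [C ^ p]. *)
Lemma norm_Hp_bounds_on_l2_sphere lam p C : injective lam -> 1 <= p -> 0 < C ->
  multiplier_bound (norm_Hp lam p) C ->
  exists A B : R, [/\ 0 < A, 0 < B & forall D, l2_sqr D = 1 ->
    A <= norm_Hp lam p D `^ p <= B].
Proof.
move=> lam_inj p1 C0 NC; have p0 : 0 < p by lra.
have Cp0 : 0 < C `^ p by exact: powR_gt0.
pose N := norm_Hp lam p.
have N0 D : 0 <= N D by have [] := has_mean_norm_Hp lam D p0.
have flip_le D (s : {ffun 'I_(size D) -> bool}) :
    N (coef_mult (signs s) D) `^ p <= C `^ p * N D `^ p.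
  rewrite -powRM ?(ltW C0) ?N0// ge0_ler_powR ?nnegrE ?mulr_ge0 ?(ltW p0)
    ?(ltW C0) ?N0//.
  by apply: NC => j; exact: normc_signs.
have flip_ge D (s : {ffun 'I_(size D) -> bool}) :
    N D `^ p <= C `^ p * N (coef_mult (signs s) D) `^ p.
  rewrite -powRM ?(ltW C0) ?N0// ge0_ler_powR ?nnegrE ?mulr_ge0 ?(ltW p0)
    ?(ltW C0) ?N0//.
  rewrite -[in leLHS](coef_mult_signsK s D).
  by apply: NC => j; exact: normc_signs.
pose f D (s : {ffun 'I_(size D) -> bool}) q t :=
  dirichlet_abs lam (coef_mult (signs s) D) t `^ q.
have cf D q : 0 < q -> forall s, continuous (@f D s q).
  by move=> q0 s; exact: continuous_dirichlet_abs_powR.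
pose E D q := \sum_(s : {ffun 'I_(size D) -> bool})
  norm_Hp lam q (coef_mult (signs s) D) `^ q.
have fE D q : 0 < q -> has_mean (fun t => \sum_s f D s q t) (E D q).
  move=> q0; apply: has_mean_sum => s; first exact: cf.
  by have [] := has_mean_norm_Hp lam (coef_mult (signs s) D) q0.
have two_gt0 n : 0 < 2 ^+ n :> R by rewrite exprn_gt0.
have absorb (w u c : R) : w <= u * c + w * 2^-1 -> w <= 2 * u * c by lra.
have [k pk] : exists k, p <= k.+1%:R.
  exists (Num.bound p); apply: (ltW (lt_le_trans (archi_boundP _) _)); first lra.
  by rewrite ler_nat.
have [Kk Kk0 momk] := dirichlet_abs_signs_moment k.
(* The argument 3 stands for the fourth moment. *)
have [K4 K40 mom4] := dirichlet_abs_signs_moment 3.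
have [L L0 interp] := sqr_le_powR_quartic p1 K40.
exists (2 * L * C `^ p)^-1, (C `^ p * (1 + Kk)); split.
- by rewrite invr_gt0 !mulr_gt0.
- by rewrite mulr_gt0//; lra.
move=> D D1; have upper : E D p <= 2 ^+ size D * (1 + Kk).
  apply: (@has_mean_le _ _ (fun=> 2 ^+ size D * (1 + Kk)) _ _ _ _ _ (fE D p p0)).
  - by apply: continuous_sum => s; exact: cf.
  - exact: cst_continuous.
  - move=> t; apply: (@le_trans _ _
      (\sum_(s : {ffun 'I_(size D) -> bool}) (1 +
        dirichlet_abs lam (coef_mult (signs s) D) t ^+ k.+1))).
      apply: ler_sum => s _; rewrite /f; set y := dirichlet_abs _ _ _.
      have y0 : 0 <= y by exact: dirichlet_abs_ge0.
      have yk0 : 0 <= y ^+ k.+1 by rewrite exprn_ge0.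
      have [y1|/ltW y1] := leP y 1.
        have : y `^ p <= 1.
          have one : 1 `^ p = 1 :> R by rewrite powR1.
          by rewrite -[leRHS]one ge0_ler_powR ?nnegrE ?(ltW p0).
        lra.
      have : y `^ p <= y ^+ k.+1 by rewrite -powR_mulrn// ler_powR.
      lra.
    by rewrite big_split/= sum_signs_cst mulrDr lerD2l; exact: momk.
  - exact: has_mean_cst.
have H2 : E D 2 = 2 ^+ size D.
  rewrite -[RHS]mulr1 -sum_signs_cst; apply: eq_bigr => s _.
  have [_ ?] := has_mean_norm_Hp lam (coef_mult (signs s) D) (ltr0Sn R 1).
  rewrite powR_mulrn// norm_H2_sqr// -D1 (@l2_sqrE (size D)) ?size_poly//.
  apply: eq_bigr => i _; rewrite coef_coef_mult Normc.normcM signsE.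
  by case: (s i); rewrite ?expr1 ?expr0 ?normcN Normc.normc1 mul1r.
have lower : 2 ^+ size D <= 2 * L * E D p.
  have : E D 2 <= L * E D p + 2 ^+ size D * 2^-1.
    have cL : continuous (fun t => L * \sum_s f D s p t).
      by move=> t; apply: cvgMr; apply: continuous_sum => s; exact: cf.
    apply: (@has_mean_le _ _
      (fun t => L * (\sum_s f D s p t) + 2 ^+ size D * 2^-1) _ _ _ _ _
      (fE D 2 (ltr0Sn R 1))).
    - by apply: continuous_sum => s; exact: cf.
    - by move=> t; apply: cvgD; [exact: cL|exact: cst_continuous].
    - move=> t; apply: (@le_trans _ _
      (\sum_(s : {ffun 'I_(size D) -> bool}) (L * f D s p t + (4 * K4)^-1 *
        dirichlet_abs lam (coef_mult (signs s) D) t ^+ 4 + 4^-1))).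
        apply: ler_sum => s _; rewrite /f powR_mulrn ?dirichlet_abs_ge0//.
        exact/interp/dirichlet_abs_ge0.
      rewrite !big_split/= sum_signs_cst -!mulr_sumr.
      have -> : 2 ^+ size D * 2^-1 = 2 ^+ size D * 4^-1 + 2 ^+ size D * 4^-1 :> R.
        by rewrite -mulrDr; congr (_ * _); field.
      rewrite -addrA lerD2l lerD2r [leLHS]mulrC ler_pdivrMr ?mulr_gt0//.
      by rewrite -mulrA mulKf//; exact: mom4.
    - apply: has_meanD => //; [exact: cst_continuous| |exact: has_mean_cst].
      by apply: has_meanZ; [apply: continuous_sum => s; exact: cf|exact: fE].
  by rewrite H2; exact: absorb.
apply/andP; split.
  rewrite -[leLHS]mulr1 ler_pdivrMl ?mulr_gt0// -(ler_pM2l (two_gt0 (size D))).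
  rewrite mulr1; apply: le_trans lower _.
  rewrite [leRHS](_ : _ = 2 * L * (2 ^+ size D * (C `^ p * N D `^ p))); last first.
    by rewrite /N; ring.
  rewrite ler_wpM2l ?mulr_ge0 ?(ltW L0)// -sum_signs_cst.
  by apply: ler_sum => s _; exact: flip_le.
rewrite -(ler_pM2l (two_gt0 (size D))) -sum_signs_cst.
apply: (@le_trans _ _ (C `^ p * E D p)).
  by rewrite mulr_sumr; apply: ler_sum => s _; exact: flip_ge.
by rewrite mulrCA ler_wpM2l// ltW.
Qed.

End Multipliers.

(** * Unconditional bases and multipliers *)

Section RealNorm.
Context {R : realType} {X : normedModType R[i]}.
Implicit Types (u v : X) (c : R[i]) (e : R).

(** The norm of [X] is complex-valued with nonnegative real values; this is the
    same norm as a real number. *)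
Definition rnorm v : R := complex.Re `|v|.

Lemma rnormE v : `|v| = (rnorm v)%:C.
Proof. by rewrite RRe_real// ger0_real. Qed.

Lemma rnorm_ge0 v : 0 <= rnorm v.
Proof. by rewrite -ler0c -rnormE. Qed.

Lemma ler_rnormD u v : rnorm (u + v) <= rnorm u + rnorm v.
Proof. by rewrite -lecR raddfD/= -!rnormE ler_normD. Qed.

Lemma rnormZ c v : rnorm (c *: v) = Normc.normc c * rnorm v.
Proof. by apply: (@complexI R); rewrite rmorphM/= -!rnormE normrZ. Qed.

Lemma rnormN v : rnorm (- v) = rnorm v.
Proof. by rewrite /rnorm normrN. Qed.

Lemma rnorm0 : rnorm (0 : X) = 0.
Proof. by rewrite /rnorm normr0. Qed.

Lemma ler_rnorm_sum (I : Type) (r : seq I) (F : I -> X) :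
  rnorm (\sum_(i <- r) F i) <= \sum_(i <- r) rnorm (F i).
Proof.
elim: r => [|i r IH]; first by rewrite !big_nil rnorm0.
by rewrite !big_cons (le_trans (ler_rnormD _ _))// lerD2l.
Qed.

Lemma cvg_rnormP (w : nat -> X) v : w @ \oo --> v <->
  forall e, 0 < e -> \forall n \near \oo, rnorm (v - w n) < e.
Proof.
split=> [/cvgrPdist_lt wv e e0|wv].
  have e0' : 0 < e%:C by rewrite ltcR.
  by near=> n; rewrite -ltcR -rnormE; near: n; exact: wv.
apply/cvgrPdist_lt => eps /gt0_complexE[-> e0]; near=> n.
by rewrite rnormE ltcR; near: n; exact: wv.
Unshelve. all: by end_near. Qed.

Lemma dense_rnormP (V : Type) (f : V -> X) v e : dense (range f) -> 0 < e ->
  exists D, rnorm (v - f D) < e.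
Proof.
move=> dense_f e0; have e0' : 0 < e%:C by rewrite ltcR.
have [y [vy [D _ yD]]] := dense_f _ (ex_intro _ v (ballxx v e0'))
  (ball_open v e%:C).
exists D; rewrite -ltcR -rnormE yD.
have : ball_ (fun x => `|x|) v e%:C y by rewrite (@ball_normE R[i] X).
by [].
Qed.

End RealNorm.

(** The value of the extension at [v] is the number within [2 M |v - iota D|] of
    [f D] for every [D].  Density makes it unique and hence linear in [v]; it
    exists because its real and imaginary parts can be taken as suprema, as in
    the Hahn-Banach theorem. *)
Lemma extend_bounded_functional {R : realType} {V : lmodType R[i]}
    {X : normedModType R[i]} (iota : {linear V -> X})
    (f : {linear V -> R[i]^o}) (M : R) : 0 < M -> dense (range iota) ->
  (forall D, Normc.normc (f D) <= M * rnorm (iota D)) ->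
  exists g : {linear X -> R[i]^o}, (forall D, g (iota D) = f D) /\
    forall v, Normc.normc (g v) <= 2 * M * rnorm v.
Proof.
move=> M0 dense_iota fM.
have fdist v D1 D2 : Normc.normc (f D1 - f D2) <=
    M * rnorm (v - iota D1) + M * rnorm (v - iota D2).
  rewrite -linearB; apply: le_trans (fM _) _; rewrite -mulrDr ler_wpM2l ?(ltW M0)//.
  rewrite linearB -(rnormN (v - iota D1)).
  have -> : iota D1 - iota D2 = - (v - iota D1) + (v - iota D2).
    by rewrite opprB addrA subrK.
  exact: ler_rnormD.
(* By hypothesis every [phi D + M |v - iota D|] is an upper bound of all
   [phi D - M |v - iota D|]; their supremum is the number sought. *)
have part (phi : V -> R) v : (forall D1 D2, phi D1 - phi D2 <=
      M * rnorm (v - iota D1) + M * rnorm (v - iota D2)) ->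
    exists r, forall D, `|r - phi D| <= M * rnorm (v - iota D).
  move=> phiM; pose S := range (fun D => phi D - M * rnorm (v - iota D)).
  have ubS D : ubound S (phi D + M * rnorm (v - iota D)).
    by move=> _ [D' _ <-]; have := phiM D' D; lra.
  have supS : has_sup S.
    by split; [exists (phi 0 - M * rnorm (v - iota 0)); exists 0|
               exists (phi 0 + M * rnorm (v - iota 0))].
  exists (sup S) => D; rewrite ler_norml.
  have h1 : sup S <= phi D + M * rnorm (v - iota D).
    by apply: ge_sup; [case: supS|exact: ubS].
  have h2 : phi D - M * rnorm (v - iota D) <= sup S.
    by apply: ub_le_sup; [case: supS|exists D].
  lra.
have exg v : exists c : R[i], forall D,
    Normc.normc (c - f D) <= 2 * M * rnorm (v - iota D).
  have [x xP] : exists r, forall D,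
      `|r - complex.Re (f D)| <= M * rnorm (v - iota D).
    apply: part => D1 D2; apply: le_trans (fdist v D1 D2).
    by apply: le_trans (Re_le_normc _); case: (f D1) (f D2) => ? ? [].
  have [y yP] : exists r, forall D,
      `|r - complex.Im (f D)| <= M * rnorm (v - iota D).
    apply: part => D1 D2; apply: le_trans (fdist v D1 D2).
    by apply: le_trans (Im_le_normc _); case: (f D1) (f D2) => ? ? [].
  exists (x +i* y) => D.
  apply: le_trans (le_add_norm_of_sqr (normc_ge0 _) (normc_sqr _)) _.
  have := xP D; have := yP D; case: (f D) => a b /=; lra.
pose g v := projT1 (cid (exg v)).
have gP v D : Normc.normc (g v - f D) <= 2 * M * rnorm (v - iota D).
  exact: (projT2 (cid (exg v))).
have small (z : R[i]) K : 0 < K -> (forall e, 0 < e -> Normc.normc z <= K * e) ->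
    z = 0.
  move=> K0 zK; apply: Normc.eq0_normc; apply/eqP.
  rewrite eq_le normc_ge0 andbT; apply/ler_addgt0Pl => e e0.
  rewrite addr0; have := zK (e / K) (divr_gt0 e0 K0).
  by rewrite mulrC divfK ?gt_eqF.
have glin : linear g.
  move=> a u v; apply/eqP; rewrite -subr_eq0; apply/eqP.
  pose A := Normc.normc a; have A0 : 0 <= A by exact: normc_ge0.
  apply: (small _ (4 * M * (A + 1))) => [|e e0]; first by rewrite !mulr_gt0//; lra.
  have [D1 D1e] := dense_rnormP u dense_iota e0.
  have [D2 D2e] := dense_rnormP v dense_iota e0.
  have split_error (x y z p q : R[i]) : x - (a * y + z) =
      (x - (a * p + q)) + (- a * (y - p) + - (z - q)) by ring.
  have -> : g (a *: u + v) - (a * g u + g v) =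
      (g (a *: u + v) - f (a *: D1 + D2)) + (- a * (g u - f D1) + - (g v - f D2)).
    by rewrite (linearP f); exact: split_error.
  have h0 : rnorm (a *: u + v - iota (a *: D1 + D2)) <= A * e + e.
    rewrite linearP opprD addrACA -scalerBr.
    apply: le_trans (ler_rnormD _ _) _; rewrite rnormZ.
    by apply: lerD; [apply: ler_wpM2l => //|]; exact: ltW.
  have h1 : Normc.normc (g (a *: u + v) - f (a *: D1 + D2)) <=
      2 * M * (A * e + e).
    by apply: le_trans (gP _ _) _; rewrite ler_wpM2l ?mulr_ge0// ltW.
  have h2 : Normc.normc (- a * (g u - f D1)) <= A * (2 * M * e).
    rewrite Normc.normcM normcN ler_wpM2l//; apply: le_trans (gP _ _) _.
    by rewrite ler_wpM2l ?mulr_ge0// ltW.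
  have h3 : Normc.normc (- (g v - f D2)) <= 2 * M * e.
    rewrite normcN; apply: le_trans (gP _ _) _.
    by rewrite ler_wpM2l ?mulr_ge0// ltW.
  have := le_normcD (g (a *: u + v) - f (a *: D1 + D2))
    (- a * (g u - f D1) + - (g v - f D2)).
  have := le_normcD (- a * (g u - f D1)) (- (g v - f D2)).
  lra.
pose gL := HB.pack_for {linear X -> R[i]^o} g
  (GRing.isLinear.Build _ _ _ _ g glin).
exists gL; split=> [D|v].
  apply/eqP; rewrite -subr_eq0; apply/eqP/Normc.eq0_normc/eqP.
  rewrite eq_le normc_ge0 andbT; apply: le_trans (gP _ _) _.
  by rewrite subrr rnorm0 mulr0.
by have := gP v 0; rewrite (linear0 f) (linear0 iota) !subr0.
Qed.

Lemma sum_delta {K : pzRingType} (f : nat -> K) n j :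
  \sum_(i < n) f i * (j == i :> nat)%:R = if (j < n)%N then f j else 0.
Proof.
case: ltnP => [jn|nj].
  rewrite (bigD1 (Ordinal jn))//= eqxx mulr1 big1 ?addr0// => i ij.
  rewrite (_ : (j == i) = false) ?mulr0//.
  by apply/negbTE; apply: contra ij => /eqP ji; apply/eqP/val_inj.
by rewrite big1// => i _; rewrite gtn_eqF ?mulr0// (leq_trans _ nj).
Qed.

Section Unconditional.
Context {R : realType} {N : dirichlet_poly R -> R}
  {X : completeNormedModType R[i]} {iota : {linear dirichlet_poly R -> X}}.
Context (completion : is_completion N iota).
Implicit Types (D : dirichlet_poly R) (a c : nat -> R[i]) (v w : X).

Local Notation e_ n := (iota (dirichlet_monomial R n)).

Lemma rnorm_iota D : rnorm (iota D) = N D.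
Proof. by rewrite /rnorm completion.1. Qed.

Let iota_expansion n a D : (size D <= n)%N ->
  iota (coef_mult a D) = series (fun j => (a j * D`_j) *: e_ j) n.
Proof.
move=> Dn; rewrite /series/= big_mkord.
have -> : coef_mult a D = \sum_(j < n) (a j * D`_j) *: 'X^j.
  rewrite -(poly_def n (fun j => a j * D`_j)); apply/polyP => i.
  rewrite coef_coef_mult coef_poly; case: ltnP => // ni.
  by rewrite nth_default ?mulr0// (leq_trans Dn).
by rewrite linear_sum; apply: eq_bigr => j _; rewrite linearZ.
Qed.

Lemma coef_mult1 D : coef_mult (fun=> 1) D = D.
Proof. by apply/polyP => i; rewrite coef_coef_mult mul1r. Qed.

(** On the image of a Dirichlet polynomial the series with multipliers is a
    finite sum, the image of the multiplied polynomial. *)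
Lemma unconditional_multiplier_bound :
  unconditional_basis (fun n => e_ n) -> exists2 C, 0 < C & multiplier_bound N C.
Proof.
move=> [_ [xs [_ bi] [C0 /gt0_complexE[-> C0_gt0] bound]]].
exists (complex.Re C0) => // a a1 D.
have xsD j : xs j (iota D) = D`_j.
  have := iota_expansion (fun=> 1) (leqnn (size D)); rewrite coef_mult1 => ->.
  rewrite /series/= big_mkord linear_sum/=.
  under eq_bigr do rewrite linearZ/= bi mul1r.
  rewrite (sum_delta (fun i => D`_i)).
  by case: ltnP => // Dj; rewrite nth_default.
have a1' j : `|a j| <= 1 by rewrite complex_norm_le1.
have [_] := bound (iota D) a a1'.
set u := series _.
have u_lim : limn u = iota (coef_mult a D).
  apply: cvg_lim => //; apply: cvg_near_cst; near=> n.
  rewrite (@iota_expansion n) /u; last by near: n; exact: nbhs_infty_ge.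
  by apply: eq_bigr => j _; rewrite xsD.
by rewrite u_lim !rnormE !rnorm_iota -rmorphM lecR.
Unshelve. all: by end_near. Qed.

(** The partial sums are bounded by [C] uniformly, first on the dense subspace,
    where they are truncated multipliers, and then everywhere; near the dense
    subspace, where they are eventually constant, this makes them Cauchy, and
    with all multipliers equal to 1 it makes them converge to the vector. *)
Lemma multiplier_bound_unconditional C : (forall n, N 'X^n = 1) -> 0 < C ->
  multiplier_bound N C -> unconditional_basis (fun n => e_ n).
Proof.
move=> N1 C0 NC.
have rnorm_e j : rnorm (e_ j) = 1 by rewrite rnorm_iota N1.
have coef_bound j D : Normc.normc D`_j <= C * rnorm (iota D).
  pose a i : R[i] := (i == j)%:R.
  have a1 i : Normc.normc (a i) <= 1.
    by rewrite /a; case: eqP => _; rewrite ?Normc.normc1 ?Normc.normc0.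
  rewrite rnorm_iota; apply: le_trans (NC a a1 D).
  have -> : coef_mult a D = D`_j *: 'X^j.
    apply/polyP => i; rewrite coef_coef_mult coefZ coefXn /a.
    by case: eqP => [->|_]; rewrite ?mulr1 ?mul1r// mul0r mulr0.
  by rewrite -rnorm_iota linearZ rnormZ rnorm_iota N1 mulr1.
have /choice[xs xsP] : forall j, exists g : {linear X -> R[i]^o},
    (forall D, g (iota D) = D`_j) /\
    forall v, Normc.normc (g v) <= 2 * C * rnorm v.
  move=> j.
  have coef_lin : linear (fun D => D`_j : R[i]^o).
    by move=> k D1 D2; rewrite coefD coefZ.
  pose f := HB.pack_for {linear dirichlet_poly R -> R[i]^o}
    (fun D : dirichlet_poly R => D`_j : R[i]^o)
    (GRing.isLinear.Build _ _ _ _ (fun D => D`_j : R[i]^o) coef_lin).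
  exact: (@extend_bounded_functional R _ X iota f C C0 completion.2
    (coef_bound j)).
have xs_iota j D : xs j (iota D) = D`_j by case: (xsP j).
have xs_bound j v : Normc.normc (xs j v) <= 2 * C * rnorm v by case: (xsP j).
have xs_e i j : xs i (e_ j) = (i == j)%:R by rewrite xs_iota coefXn.
pose S a v := series (fun j => (a j * xs j v) *: e_ j).
have SB a v w m : S a (v + w) m = S a v m + S a w m.
  rewrite /S /series/= -big_split/=; apply: eq_bigr => j _.
  by rewrite linearD mulrDr scalerDl.
have S_iota a D m : (size D <= m)%N -> S a (iota D) m = iota (coef_mult a D).
  move=> Dm; rewrite (iota_expansion a Dm); apply: eq_bigr => j _.
  by rewrite xs_iota.
have dense_iota := completion.2.
have S_bound_iota a D m : (forall j, Normc.normc (a j) <= 1) ->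
    rnorm (S a (iota D) m) <= C * rnorm (iota D).
  move=> a1; pose b j := if (j < m)%N then a j else 0.
  have -> : S a (iota D) m = iota (coef_mult b D).
    rewrite -(S_iota b D (maxn m (size D))) ?leq_maxr//.
    rewrite /S /series/= (big_cat_nat _ (leq_maxl m (size D)))//=.
    rewrite [X in _ = _ + X]big_nat_cond [X in _ = _ + X]big1 ?addr0.
      by apply: eq_big_nat => j /andP[_ jm]; rewrite /b jm.
    move=> j /andP[/andP[mj _] _].
    by rewrite /b ltnNge mj/= mul0r scale0r.
  rewrite !rnorm_iota; apply: NC => j; rewrite /b; case: ifP => // _.
  by rewrite Normc.normc0.
have S_bound a v m : (forall j, Normc.normc (a j) <= 1) ->
    rnorm (S a v m) <= C * rnorm v.
  move=> a1; pose B := \sum_(0 <= j < m) (2 * C).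
  have B0 : 0 <= B by apply: sumr_ge0 => j _; rewrite mulr_ge0 ?(ltW C0).
  (* This bound grows with [m]; it serves to carry the uniform one from the dense
     subspace over to [v]. *)
  have crude w : rnorm (S a w m) <= B * rnorm w.
    apply: le_trans (ler_rnorm_sum _ _) _; rewrite mulr_suml.
    apply: ler_sum => j _; rewrite rnormZ rnorm_e mulr1.
    exact: le_trans (normc_mult_le _ (a1 j)) (xs_bound j w).
  apply/ler_addgt0Pl => e e0.
  have BC0 : 0 < B + C by rewrite ltr_wpDl.
  have [D De] := dense_rnormP v dense_iota (divr_gt0 e0 BC0).
  have {}De : (B + C) * rnorm (v - iota D) <= e.
    by rewrite mulrC -ler_pdivlMr// ltW.
  rewrite -[in leLHS](subrK (iota D) v) SB.
  have h1 := ler_rnormD (S a (v - iota D) m) (S a (iota D) m).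
  have h2 := crude (v - iota D); have h3 := S_bound_iota a D m a1.
  have h4 : rnorm (iota D) <= rnorm v + rnorm (v - iota D).
    have := ler_rnormD v (- (v - iota D)).
    by rewrite rnormN opprB addrC subrK.
  have h5 : C * rnorm (iota D) <= C * (rnorm v + rnorm (v - iota D)).
    by rewrite ler_wpM2l ?(ltW C0).
  lra.
have S_cvg_bound a v : (forall j, Normc.normc (a j) <= 1) ->
    cvgn (S a v) /\ rnorm (limn (S a v)) <= C * rnorm v.
  move=> a1; have Sc : cvgn (S a v).
    apply/cauchy_cvgP/cauchy_exP => eps /gt0_complexE[-> e0].
    set e := complex.Re eps in e0 *.
    have [D De] := dense_rnormP v dense_iota (divr_gt0 e0 C0).
    exists (iota (coef_mult a D)); rewrite /= nbhs_simpl/=; near=> m.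
    rewrite -(@ball_normE R[i] X)/= -(S_iota a D m); last first.
      by near: m; exact: nbhs_infty_ge.
    rewrite -normrN opprB -{1}(subrK (iota D) v) SB addrK rnormE ltcR.
    by rewrite (le_lt_trans (S_bound _ _ _ a1))// mulrC -ltr_pdivlMr.
  split=> //; apply/ler_addgt0Pl => e e0.
  have /cvg_rnormP/(_ _ e0)[n _ /(_ n (leqnn n))/= Sn] := Sc.
  have h1 := ler_rnormD (limn (S a v) - S a v n) (S a v n).
  have h2 := S_bound a v n a1; rewrite subrK in h1; lra.
have S1_cvg v : S (fun=> 1) v @ \oo --> v.
  apply/cvg_rnormP => e e0; have C10 : 0 < C + 1 by rewrite addr_gt0.
  have [D De] := dense_rnormP v dense_iota (divr_gt0 e0 C10).
  near=> m; have mD : (size D <= m)%N by near: m; exact: nbhs_infty_ge.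
  have one1 (j : nat) : Normc.normc (1 : R[i]) <= 1 by rewrite Normc.normc1.
  have h1 := S_bound (fun=> 1) (v - iota D) m one1.
  have -> : v - S (fun=> 1) v m = (v - iota D) - S (fun=> 1) (v - iota D) m.
    have -> : S (fun=> 1) v m = S (fun=> 1) (v - iota D) m + iota D.
      by rewrite -[in LHS](subrK (iota D) v) (SB _ (v - _)) S_iota// coef_mult1.
    by rewrite opprD addrA addrAC.
  have h2 := ler_rnormD (v - iota D) (- S (fun=> 1) (v - iota D) m).
  apply: le_lt_trans h2 _; rewrite rnormN; move: De; rewrite ltr_pdivlMr//.
  by apply: le_lt_trans; rewrite mulrDr mulr1 addrC lerD2r [leRHS]mulrC.
split=> [v|].
  exists (fun j => xs j v); split=> [|c cv].
    have := S1_cvg v; rewrite /S.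
    by under [in X in X -> _]eq_fun do rewrite mul1r.
  apply/funext => j; apply/eqP; rewrite -subr_eq0; apply/eqP/Normc.eq0_normc.
  apply/eqP; rewrite eq_le normc_ge0 andbT; apply/ler_addgt0Pl => e e0.
  have C20 : 0 < 2 * C by rewrite mulr_gt0.
  have /cvg_rnormP/(_ _ (divr_gt0 e0 C20)) cve := cv.
  near \oo => n.
  have -> : xs j v - c j = xs j (v - series (fun j => c j *: e_ j) n).
    rewrite linearB; congr (_ - _); rewrite /series/= linear_sum/=.
    under eq_bigr do rewrite linearZ/= xs_e.
    have jn : (j < n)%N by near: n; exact: nbhs_infty_gt.
    by rewrite big_mkord (sum_delta c) jn.
  rewrite addr0; apply: le_trans (xs_bound _ _) _.
  by rewrite mulrC -ler_pdivlMr// ltW//; near: n.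
exists xs.
  split=> // j; apply: bounded_linear_continuous; apply/linear_boundedP.
  exists (2 * C)%:C; split; first by
    rewrite ger0_real// ler0c mulr_ge0 ?(ltW C0).
  move=> r Cr v; rewrite !rnormE; apply: (@le_trans _ _ ((2 * C)%:C * (rnorm v)%:C)).
    by rewrite -rmorphM lecR; exact: xs_bound.
  by rewrite ler_wpM2r ?(ltW Cr) ?ler0c ?rnorm_ge0.
exists C%:C; first by rewrite ltcR.
move=> v a a1 u; have a1' j : Normc.normc (a j) <= 1 by rewrite -complex_norm_le1.
have [Sc Sb] := S_cvg_bound a v a1'; split=> //.
by rewrite !rnormE -rmorphM lecR.
Unshelve. all: by end_near. Qed.

End Unconditional.

(** * Comparison of the norms *)

Section Comparison.
Context {R : realType}.
Implicit Types (lam : nat -> R) (D : dirichlet_poly R) (N : dirichlet_poly R -> R).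

Lemma equivalent_norms_multiplier_bound N N' :
  equivalent_norms N N' ->
  (forall a D, (forall n, Normc.normc (a n) <= 1) ->
    N' (coef_mult a D) <= N' D) ->
  exists2 C, 0 < C & multiplier_bound N C.
Proof.
move=> [c [C [c0 C0 NN']]] N'_mult; exists (c^-1 * C).
  by rewrite mulr_gt0 ?invr_gt0.
move=> a a1 D; rewrite -mulrA ler_pdivlMl//.
apply: le_trans (NN' _).1 _; apply: le_trans (N'_mult a D a1) _.
exact: (NN' D).2.
Qed.

Lemma dirichlet_abs_monomial lam n t : dirichlet_abs lam 'X^n t = 1.
Proof.
rewrite /dirichlet_abs (@dirichlet_evalE _ n.+1) ?size_polyXn//.
rewrite big_ord_recr/= big1 => [|i _]; last first.
  by rewrite coefXn ltn_eqF// mul0r.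
by rewrite add0r coefXn eqxx mul1r normc_cis.
Qed.

Lemma norm_Hp_monomial lam p n : 0 < p -> norm_Hp lam p 'X^n = 1.
Proof.
move=> p0; have [Xm X0] := has_mean_norm_Hp lam 'X^n p0.
have one q : 1 `^ q = 1 :> R by rewrite powR1.
have : norm_Hp lam p 'X^n `^ p = 1.
  apply: has_mean_unique Xm _.
  under eq_fun do rewrite dirichlet_abs_monomial one; exact: has_mean_cst.
move=> /(congr1 (fun x => x `^ p^-1)).
by rewrite one -powRrM mulfV ?gt_eqF// powRr1.
Qed.

Lemma norm_Hoo_monomial lam n : norm_Hoo lam 'X^n = 1.
Proof.
rewrite /norm_Hoo [X in sup X](_ : _ = [set 1]) ?sup1//.
apply/seteqP; split=> [_ [t _ <-]|_ ->]; first exact: dirichlet_abs_monomial.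
by exists 0 => //; exact: dirichlet_abs_monomial.
Qed.

Lemma l2_sqrZ (k : R[i]) D : l2_sqr (k *: D) = Normc.normc k ^+ 2 * l2_sqr D.
Proof.
rewrite (@l2_sqrE _ (size D)) ?size_scale_leq// mulr_sumr.
by apply: eq_bigr => i _; rewrite coefZ Normc.normcM exprMn.
Qed.

Lemma l2_sqr_eq0 D : l2_sqr D = 0 -> D = 0.
Proof.
move=> /eqP; rewrite psumr_eq0 => [/allP D0|i _]; last exact: sqr_ge0.
apply/polyP => i; rewrite coef0; have [iD|Di] := ltnP i (size D); last first.
  by rewrite nth_default.
have := D0 (Ordinal iD) (mem_index_enum _).
by rewrite sqrf_eq0 => /eqP/Normc.eq0_normc.
Qed.

Lemma norm_H2_mult_le lam a D : injective lam ->
  (forall n, Normc.normc (a n) <= 1) ->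
  norm_Hp lam 2 (coef_mult a D) <= norm_Hp lam 2 D.
Proof.
move=> lam_inj a1; have := l2_sqr_mult_le D a1.
rewrite -(norm_H2_sqr D lam_inj) -(norm_H2_sqr (coef_mult a D) lam_inj).
have [_] := has_mean_norm_Hp lam D (ltr0Sn R 1).
have [_] := has_mean_norm_Hp lam (coef_mult a D) (ltr0Sn R 1).
move: (norm_Hp lam 2 D) (norm_Hp lam 2 (coef_mult a D)) => x y y0 x0.
by rewrite ler_pXn2r.
Qed.

Lemma powR_ratio_bounds (p A B k n : R) : 0 < p -> 0 < A -> 0 < k -> 0 < B ->
  0 <= n -> A <= (k^-1 * n) `^ p <= B ->
  (B `^ p^-1)^-1 * n <= k /\ k <= (A `^ p^-1)^-1 * n.
Proof.
move=> p0 A0 k0 B0 n0; set x := k^-1 * n => /andP[Ax xB].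
have x0 : 0 <= x by rewrite mulr_ge0// invr_ge0 ltW.
have nE : n = k * x by rewrite /x mulVKf ?gt_eqF.
have rootK : (x `^ p) `^ p^-1 = x by rewrite -powRrM mulfV ?gt_eqF// powRr1.
have root_mono (y z : R) : 0 <= y -> y <= z -> y `^ p^-1 <= z `^ p^-1.
  move=> y0 yz; rewrite ge0_ler_powR ?nnegrE ?invr_ge0 ?(ltW p0)//.
  exact: le_trans yz.
have xB' := root_mono _ _ (powR_ge0 x p) xB.
have Ax' := root_mono _ _ (ltW A0) Ax.
rewrite rootK in xB' Ax'; rewrite nE; split.
  by rewrite ler_pdivrMl ?powR_gt0// mulrC ler_wpM2r ?(ltW k0).
by rewrite ler_pdivlMl ?powR_gt0// mulrC ler_wpM2l ?(ltW k0).
Qed.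

(** Homogeneity carries the bounds on the sphere of the Hilbert norm to all
    Dirichlet polynomials. *)
Lemma multiplier_bound_equivalent_H2 lam p C : injective lam -> 1 <= p ->
  (forall k D, norm_Hp lam p (k *: D) = Normc.normc k * norm_Hp lam p D) ->
  0 < C -> multiplier_bound (norm_Hp lam p) C ->
  equivalent_norms (norm_Hp lam p) (norm_Hp lam 2).
Proof.
move=> lam_inj p1 NZ C0 NC; have p0 : 0 < p by lra.
have [A [B [A0 B0 AB]]] := norm_Hp_bounds_on_l2_sphere lam_inj p1 C0 NC.
have root_gt0 (x : R) : 0 < x -> 0 < x `^ p^-1 by exact: powR_gt0.
exists (B `^ p^-1)^-1, (A `^ p^-1)^-1; split; rewrite ?invr_gt0 ?root_gt0//.
move=> D; have [_ N2_ge0] := has_mean_norm_Hp lam D (ltr0Sn R 1).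
have N2_sqr := norm_H2_sqr D lam_inj.
have [D0|D0] := eqVneq (norm_Hp lam 2 D) 0.
  have -> : norm_Hp lam p D = 0.
    have -> : D = 0 *: D.
      by rewrite scale0r; apply: l2_sqr_eq0; rewrite -N2_sqr D0 expr0n.
    by rewrite NZ Normc.normc0 mul0r.
  by rewrite D0 !mulr0.
have k0 : 0 < norm_Hp lam 2 D by rewrite lt_neqAle eq_sym D0.
set k := norm_Hp lam 2 D in N2_sqr k0 *.
have nk : Normc.normc (k^-1)%:C = k^-1 :> R.
  by rewrite normc_nonneg// invr_ge0 ltW.
have D'1 : l2_sqr ((k^-1)%:C *: D) = 1.
  by rewrite l2_sqrZ nk -N2_sqr -exprMn mulVf ?expr1n ?gt_eqF.
have := AB _ D'1; rewrite NZ nk; have [_] := has_mean_norm_Hp lam D p0.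
exact: powR_ratio_bounds.
Qed.

Lemma norm_ell1E n D : (size D <= n)%N ->
  norm_ell1 D = \sum_(i < n) Normc.normc D`_i.
Proof.
move=> Dn; rewrite /norm_ell1.
rewrite (big_ord_widen n (fun i => Normc.normc D`_i))// big_mkcond/=.
apply: eq_bigr => i _; case: ltnP => // Di.
by rewrite nth_default// Normc.normc0.
Qed.

Lemma norm_ell1_mult_le (a : nat -> R[i]) D :
  (forall n, Normc.normc (a n) <= 1) ->
  norm_ell1 (coef_mult a D) <= norm_ell1 D.
Proof.
move=> a1; rewrite (@norm_ell1E (size D)) ?size_poly//; apply: ler_sum => i _.
by rewrite coef_coef_mult normc_mult_le.
Qed.

Lemma dirichlet_abs_le_ell1 lam D t : dirichlet_abs lam D t <= norm_ell1 D.
Proof.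
rewrite /dirichlet_abs (dirichlet_evalE lam t (leqnn (size D))) /norm_ell1.
elim/big_ind2: _ => [|x1 x2 y1 y2 h1 h2|i _]; first by rewrite Normc.normc0.
  exact: le_trans (le_normcD _ _) (lerD h1 h2).
by rewrite Normc.normcM normc_cis mulr1.
Qed.

Lemma norm_Hoo_le_ell1 lam D : norm_Hoo lam D <= norm_ell1 D.
Proof.
apply: ge_sup; first by exists (dirichlet_abs lam D 0); exists 0.
by move=> _ [t _ <-]; exact: dirichlet_abs_le_ell1.
Qed.

(** Rotating every coefficient to its modulus makes all terms add up at
    [t = 0]. *)
Lemma multiplier_bound_ell1_le lam C : multiplier_bound (norm_Hoo lam) C ->
  forall D, norm_ell1 D <= C * norm_Hoo lam D.
Proof.
move=> NC D; pose a n : R[i] := (Normc.normc D`_n)%:C / D`_n.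
have a1 n : Normc.normc (a n) <= 1.
  rewrite /a; have [->|Dn0] := eqVneq D`_n 0.
    by rewrite Normc.normc0 mul0r Normc.normc0.
  rewrite Normc.normcM Normc.normcV normc_nonneg ?normc_ge0// mulfV//.
  by apply: contra_neq Dn0 => /Normc.eq0_normc.
have aD n : a n * D`_n = (Normc.normc D`_n)%:C.
  rewrite /a; have [->|Dn0] := eqVneq D`_n 0; last by rewrite divfK.
  by rewrite mulr0 Normc.normc0.
apply: le_trans (NC a a1 D).
have -> : norm_ell1 D = dirichlet_abs lam (coef_mult a D) 0.
  rewrite /dirichlet_abs (@dirichlet_evalE _ (size D)) ?size_poly//.
  under eq_bigr do rewrite coef_coef_mult aD mulr0 cos0 sin0 oppr0 mulr1.
  rewrite -rmorph_sum normc_nonneg ?sumr_ge0// => i _; exact: normc_ge0.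
apply: ub_le_sup; last by exists 0.
by exists (norm_ell1 (coef_mult a D)) => _ [t _ <-]; exact: dirichlet_abs_le_ell1.
Qed.

End Comparison.

Theorem proposition4p1 (R : realType) (lam : nat -> R) (hlam : frequency lam) :
  (forall (p : R), 1 <= p ->
   forall (Hp : completeNormedModType R[i])
     (iota : {linear dirichlet_poly R -> Hp}),
     is_completion (norm_Hp lam p) iota ->
     (unconditional_basis (fun n => iota (dirichlet_monomial R n)) <->
      equivalent_norms (norm_Hp lam p) (norm_Hp lam 2))) /\
  (forall (Aoo : completeNormedModType R[i])
     (iota : {linear dirichlet_poly R -> Aoo}),
     is_completion (norm_Hoo lam) iota ->
     (unconditional_basis (fun n => iota (dirichlet_monomial R n)) <->
      equivalent_norms (norm_Hoo lam) (@norm_ell1 R))).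
Proof.
have lam_inj : injective lam.
  case: hlam => _ lam_mono _ m n mn; case: (ltngtP m n) => // /lam_mono.
    by rewrite mn ltxx.
  by rewrite mn ltxx.
split=> [p p1 Hp iota compl|Aoo iota compl]; split.
- move=> /(unconditional_multiplier_bound compl)[C C0 NC].
  apply: multiplier_bound_equivalent_H2 NC => // k D.
  by rewrite -!(rnorm_iota compl) linearZ rnormZ.
- move=> equiv; have p0 : 0 < p by lra.
  have [|C C0 NC] := equivalent_norms_multiplier_bound equiv.
    by move=> a D; exact: norm_H2_mult_le.
  apply: (multiplier_bound_unconditional compl _ C0 NC) => n.
  exact: norm_Hp_monomial.
- move=> /(unconditional_multiplier_bound compl)[C C0 NC].
  exists 1, C; split=> // D; rewrite mul1r; split; first exact: norm_Hoo_le_ell1.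
  exact: multiplier_bound_ell1_le.
- move=> equiv; have [|C C0 NC] := equivalent_norms_multiplier_bound equiv.
    exact: norm_ell1_mult_le.
  apply: (multiplier_bound_unconditional compl _ C0 NC) => n.
  exact: norm_Hoo_monomial.
Qed.
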